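(* Let $\alpha\ge1$ be such that $2\alpha-1$ is an integer, and let $N$ be the integer part of $\alpha$. There exist constants $a>0$ and $A>0$, depending only on $\alpha$, such that for all integers $n\ge1$ and all $r\in[0,1)$, $$a\left(\frac{n}{1-r}\right)^{\frac{2\alpha-1}{2}}\le C_{n,r}\left(l_a^2(\alpha),H^\infty\right)\le A\left(\frac{n}{1-r}\right)^{\frac{2\alpha-1}{2}},$$ where the constants $a$ and $A$ satisfy $a\asymp\frac{1}{2^{3N}(2N)!}$ and $A\asymp N^{2N}$. Moreover, the upper bound holds for every real $\alpha\ge1$.
   Context: $\mathbb{D}=\{z\in\mathbb{C}:|z|<1\}$, $\mathrm{Hol}(\mathbb{D})$ is the space of holomorphic functions on $\mathbb{D}$, and $H^\infty$ is the space of bounded holomorphic functions on $\mathbb{D}$ with norm $\|f\|_\infty=\sup_{z\in\mathbb{D}}|f(z)|$. For $\alpha\ge1$, $l_a^2(\alpha)=l_a^2\left(\frac{1}{(k+1)^{\alpha-1}}\right)$ is the space of functions $f(z)=\sum_{k\ge0}\hat f(k)z^k$ on $\mathbb{D}$ with $$\|f\|^2=\sum_{k\ge0}|\hat f(k)|^2\frac{1}{(k+1)^{2(\alpha-1)}}<\infty.$$ A finite set $\sigma=\{\lambda_1,\dots,\lambda_n\}\subset\mathbb{D}$ is understood as a finite family in which points may be repeated; $\#\sigma$ counts multiplicities. Put $B=\prod_{i=1}^n b_{\lambda_i}$ with $b_\lambda(z)=\frac{\lambda-z}{1-\overline{\lambda}z}$. For $f,g\in\mathrm{Hol}(\mathbb{D})$,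 the condition $g_{|\sigma}=f_{|\sigma}$ means $f-g\in B\,\mathrm{Hol}(\mathbb{D})$ (interpolation counted with multiplicity). For Banach spaces $X\supset Y$ of holomorphic functions on $\mathbb{D}$, $$c(\sigma,X,Y)=\sup_{f\in X,\ \|f\|_X\le1}\ \inf\{\|g\|_Y:\ g\in Y,\ g_{|\sigma}=f_{|\sigma}\},$$ and for an integer $n\ge1$ and $r\in[0,1)$, $$C_{n,r}(X,Y)=\sup\{c(\sigma,X,Y):\ \#\sigma\le n,\ |\lambda|\le r\ \text{for all }\lambda\in\sigma\}.$$ The notation $x\asymp y$ means that there are numerical (absolute) constants $c_1,c_2>0$ such that $c_1y\le x\le c_2y$. *)

(* Defs.v *)
From Stdlib Require Import Reals List ClassicalEpsilon.
From Coquelicot Require Import Coquelicot.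
Open Scope R_scope.

Definition inD (z : C) : Prop := Cmod z < 1.

(* Written over the classical reals of the standard library, with Coquelicot.
   Functions on the disc are total functions C -> C of which only the values
   on the disc matter.  [ex_derive] is complex differentiability here: the
   scalar field is C. *)
Definition Hol (f : C -> C) : Prop :=
  forall z : C, inD z -> @ex_derive C_AbsRing C_NormedModule f z.

(* A normed space of holomorphic functions on the disc, given by its membership
   predicate and its norm; the value of the norm on non-members is irrelevant. *)
Record funSpace : Type := FunSpace {
  mem : (C -> C) -> Prop;
  fnorm : (C -> C) -> R
}.

Definition Hinf : funSpace := FunSpace
  (fun f => Hol f /\ exists M : R, forall z : C, inD z -> Cmod (f z) <= M)
  (fun f => real (Lub_Rbar (fun x : R => exists z : C, inD z /\ x = Cmod (f z)))).

Definition is_taylor (f : C -> C) (a : nat -> C) : Prop :=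
  forall z : C, inD z -> @is_pseries C_AbsRing C_NormedModule a z (f z).

(* The sequence of Taylor coefficients at 0, determined uniquely by [is_taylor]
   whenever such a sequence exists, and arbitrary otherwise. *)
Definition coeffs (f : C -> C) : nat -> C :=
  epsilon (inhabits (fun _ : nat => RtoC 0)) (is_taylor f).

Definition l2a_term (alpha : R) (f : C -> C) (k : nat) : R :=
  (Cmod (coeffs f k)) ^ 2 * (1 / Rpower (INR k + 1) (2 * (alpha - 1))).

Definition l2a (alpha : R) : funSpace := FunSpace
  (fun f => (exists a : nat -> C, is_taylor f a) /\ ex_series (l2a_term alpha f))
  (fun f => sqrt (Series (l2a_term alpha f))).

Definition blaschke_factor (lambda z : C) : C :=
  ((lambda - z) / (1 - Cconj lambda * z))%C.

(* A finite family of points, repetitions allowed, is a list. *)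
Definition blaschke (sigma : list C) (z : C) : C :=
  fold_right Cmult (RtoC 1) (map (fun lambda => blaschke_factor lambda z) sigma).

Definition agree_on (sigma : list C) (g f : C -> C) : Prop :=
  exists h : C -> C, Hol h /\
    forall z : C, inD z -> (f z - g z)%C = (blaschke sigma z * h z)%C.

(* Extended-real valued; the infimum over an empty set is p_infty. *)
Definition c_interp (sigma : list C) (X Y : funSpace) : Rbar :=
  Rbar_lub (fun s : Rbar => exists f : C -> C, mem X f /\ fnorm X f <= 1 /\
    s = Rbar_glb (fun t : Rbar => exists g : C -> C,
          mem Y g /\ agree_on sigma g f /\ t = Finite (fnorm Y g))).

Definition C_interp (n : nat) (r : R) (X Y : funSpace) : Rbar :=
  Rbar_lub (fun s : Rbar => exists sigma : list C,
    (length sigma <= n)%nat /\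
    (forall lambda : C, In lambda sigma -> Cmod lambda <= r) /\
    s = c_interp sigma X Y).

(* The constants c1, c2 are absolute: they do not depend on alpha. *)
Definition asymp_on (P : R -> Prop) (x y : R -> R) : Prop :=
  exists c1 c2 : R, 0 < c1 /\ 0 < c2 /\
    forall alpha : R, P alpha -> c1 * y alpha <= x alpha <= c2 * y alpha.

Definition is_integer (x : R) : Prop := exists m : Z, x = IZR m.

Definition floor_nat (x : R) : nat := Z.to_nat (Int_part x).

(* Main.v *)
(** Upper bound.  With [delta = (1 - r) / (4 n)] and [R0 = exp (- delta)], a function of norm
    at most 1 in [l2a alpha] has on the circle of radius [R0] an [L^2] norm of order
    [(N n / (1 - r)) ^ (alpha - 1)].  Its interpolant is the orthogonal projection, in the Hardy
    space of the disc of radius [R0], onto the span of the Malmquist-Takenaka basis at the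
    nodes, computed by the Schur algorithm.  Since [R0] is so close to 1, each basis function
    is still of size at most a constant times [(1 - r) ^ (-1/2)] on the whole unit disc, and
    Cauchy-Schwarz gives the remaining factor [(n / (1 - r)) ^ (1/2)].

    Lower bound.  Take [n] copies of the node [r] and, with [p = 2 alpha - 1],
    [f z = (1 - rho^2)^(p/2) / (1 - rho z)^p], whose norm is at most 1.  The disc automorphism
    [z |-> (r + z) / (1 + r z)] moves the node to 0 and turns [f] into a multiple of
    [(1 + r z)^p / (1 - beta z)^p], [beta = n / (n + 1)], which has nonnegative Taylor
    coefficients.  An interpolant shares the first [n] of them, so that its sup norm is at
    least their Fejer sum at 1.  Averaging against the Fejer kernel needs the mean value
    property of functions that are merely complex differentiable, obtained from Goursat's
    theorem in the coordinate [log z]. *)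

(* A function in [l2a alpha] need not have boundary values, so the projection cannot be taken on the
   unit circle. The price of the smaller disc is that its Blaschke factors may exceed 1 in modulus
   on the unit disc; [delta] is proportional to (1 - r) / n so that each of at most n factors costs
   1 + 8 / n in square modulus, hence all of them together at most exp 8.

   In the lower bound, Fejer sums replace plain Taylor sums because the Fejer kernel is positive:
   the sup norm controls them without a logarithm. The value n / (n + 1) of [beta] keeps [beta ^ k]
   above 1 / e for k < n, while 1 - [beta] is still of order 1 / n. Integrality of 2 alpha - 1 makes
   (1 + r z)^p a polynomial with nonnegative coefficients.

   No complex integral is ever formed. Parseval's identity becomes a telescoping sum of
   coefficients, and the mean value property becomes a statement on the sign of a real part at the
   centre. An element of [Hinf] is only known to be complex differentiable, so its low-order
   coefficients are expressed by division by z^n. *)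
Require Import Defs.
From Stdlib Require Import Reals List Factorial.
From Stdlib Require Import ZArith Lra Lia ClassicalEpsilon FunctionalExtensionality.
From Coquelicot Require Import Coquelicot.
Open Scope R_scope.

(** * Complex derivatives *)

(* Derivatives in the normed module of the ring [C_AbsRing], for which Coquelicot has the
   product and chain rules; [Hol] uses the module [C_NormedModule]. *)
Definition cdiff (f : C -> C) (z l : C) : Prop :=
  @is_derive C_AbsRing (AbsRing_NormedModule C_AbsRing) f z l.

Lemma cdiff_eps (f : C -> C) (z l : C) :
  cdiff f z l <->
  forall eps, 0 < eps -> exists del, 0 < del /\ forall w, Cmod (w - z) < del ->
    Cmod (f w - f z - l * (w - z)) <= eps * Cmod (w - z).
Proof.
  split.
  - intros [_ H] e He. specialize (H z (fun P h => h)).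
    destruct (H (mkposreal e He)) as [d Hd].
    exists d. split; [apply cond_pos|]. intros w Hw. specialize (Hd w Hw).
    replace (f w - f z - l * (w - z))%C with (f w - f z - (w - z) * l)%C by ring.
    exact Hd.
  - intros H. split; [apply is_linear_scal_l|]. intros x Hx.
    apply (@is_filter_lim_locally_unique C_AbsRing (AbsRing_NormedModule C_AbsRing)) in Hx.
    subst x.
    intros [e He]. destruct (H e He) as [d [Hd K]].
    exists (mkposreal d Hd). intros w Hw. specialize (K w Hw).
    replace (f w - f z - l * (w - z))%C with (f w - f z - (w - z) * l)%C in K by ring.
    exact K.
Qed.

Lemma Hol_cdiff (f : C -> C) :
  Hol f <-> forall z, inD z -> exists l, cdiff f z l.
Proof.
  split; intros H z Hz; destruct (H z Hz) as [l [_ Hl]]; exists l;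
    (split; [apply is_linear_scal_l|exact Hl]).
Qed.

Lemma cdiff_const (c z : C) : cdiff (fun _ => c) z 0.
Proof. exact (@is_derive_const C_AbsRing (AbsRing_NormedModule C_AbsRing) c z). Qed.

Lemma cdiff_id (z : C) : cdiff (fun w => w) z 1.
Proof. exact (@is_derive_id C_AbsRing z). Qed.

Lemma cdiff_plus (f g : C -> C) (z l m : C) :
  cdiff f z l -> cdiff g z m -> cdiff (fun w => f w + g w)%C z (l + m)%C.
Proof. exact (@is_derive_plus C_AbsRing (AbsRing_NormedModule C_AbsRing) f g z l m). Qed.

Lemma cdiff_mult (f g : C -> C) (z l m : C) :
  cdiff f z l -> cdiff g z m ->
  cdiff (fun w => f w * g w)%C z (l * g z + f z * m)%C.
Proof.
  intros Hf Hg.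
  exact (@is_derive_mult C_AbsRing f g z l m Hf Hg Cmult_comm).
Qed.

Lemma cdiff_comp (f g : C -> C) (z l m : C) :
  cdiff f (g z) l -> cdiff g z m -> cdiff (fun w => f (g w)) z (m * l)%C.
Proof.
  exact (@is_derive_comp C_AbsRing (AbsRing_NormedModule C_AbsRing) f g z l m).
Qed.

Lemma cdiff_inv (z : C) : z <> 0%C -> cdiff (fun w => / w)%C z (- / (z * z))%C.
Proof.
  intros Hz. apply cdiff_eps. intros e He.
  assert (Hm := proj1 (Cmod_gt_0 z) Hz).
  set (m := Cmod z) in *.
  (* The error is (w - z)^2 / (w z^2). The first radius keeps |w| above m / 2, which bounds it by 2
     |w - z|^2 / m^3; the second radius turns this into [e] times |w - z|. *)
  exists (Rmin (m / 2) (e * m ^ 3 / 2)). split.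
  { apply Rmin_glb_lt; [lra|]. assert (0 < m ^ 3) by (apply pow_lt; lra). nra. }
  intros w Hw.
  assert (H1 : Cmod (w - z) < m / 2) by (eapply Rlt_le_trans; [exact Hw|apply Rmin_l]).
  assert (H2 : Cmod (w - z) < e * m ^ 3 / 2) by (eapply Rlt_le_trans; [exact Hw|apply Rmin_r]).
  assert (H3 : m / 2 < Cmod w).
  { assert (T := Cmod_triangle w (z - w)). replace (w + (z - w))%C with z in T by ring.
    replace (z - w)%C with (- (w - z))%C in T by ring. rewrite Cmod_opp in T.
    fold m in T. lra. }
  assert (Hw0 : w <> 0%C) by (apply Cmod_gt_0; lra).
  replace (/ w - / z - - / (z * z) * (w - z))%C
    with ((w - z) * (w - z) * / (w * (z * z)))%C by (field; auto).
  assert (z * z <> 0)%C by (now apply Cmult_neq_0).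
  rewrite !Cmod_mult, Cmod_inv, !Cmod_mult by (now apply Cmult_neq_0).
  fold m.
  assert (Hd := Cmod_ge_0 (w - z)). set (d := Cmod (w - z)) in *. set (v := Cmod w) in *.
  rewrite (Rmult_comm e d), Rmult_assoc. apply Rmult_le_compat_l; [lra|].
  assert (Hmm : 0 < m * m) by nra.
  assert (Hv : 0 < v * (m * m)) by (apply Rmult_lt_0_compat; lra).
  apply Rmult_le_reg_r with (v * (m * m)); [exact Hv|].
  rewrite Rmult_assoc, Rinv_l by lra.
  assert (m / 2 * (e * (m * m)) <= v * (e * (m * m))) by (apply Rmult_le_compat_r; nra).
  nra.
Qed.

Lemma cdiff_locally (f g : C -> C) (z l : C) (r : R) :
  0 < r -> (forall w, Cmod (w - z) < r -> f w = g w) -> cdiff f z l -> cdiff g z l.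
Proof.
  intros Hr Hfg H.
  apply (@is_derive_ext_loc C_AbsRing (AbsRing_NormedModule C_AbsRing) f g z l);
    [exists (mkposreal r Hr); exact Hfg|exact H].
Qed.

Lemma inD_ball (z w : C) : inD z -> Cmod (w - z) < 1 - Cmod z -> inD w.
Proof.
  unfold inD. intros Hz Hw. assert (T := Cmod_triangle z (w - z)).
  replace (z + (w - z))%C with w in T by ring. lra.
Qed.

Lemma Hol_ext (f g : C -> C) : (forall z, inD z -> f z = g z) -> Hol f -> Hol g.
Proof.
  rewrite !Hol_cdiff. intros Hfg H z Hz. destruct (H z Hz) as [l Hl].
  exists l. apply (cdiff_locally f g z l (1 - Cmod z)); [unfold inD in Hz; lra| |exact Hl].
  intros w Hw. apply Hfg. now apply inD_ball with z.
Qed.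

Lemma Hol_const (c : C) : Hol (fun _ => c).
Proof. apply Hol_cdiff. intros z _. eexists. apply cdiff_const. Qed.

Lemma Hol_id : Hol (fun z => z).
Proof. apply Hol_cdiff. intros z _. eexists. apply cdiff_id. Qed.

Lemma Hol_plus (f g : C -> C) : Hol f -> Hol g -> Hol (fun z => f z + g z)%C.
Proof.
  rewrite !Hol_cdiff. intros Hf Hg z Hz.
  destruct (Hf z Hz) as [l Hl], (Hg z Hz) as [m Hm]. eexists. exact (cdiff_plus f g z l m Hl Hm).
Qed.

Lemma Hol_mult (f g : C -> C) : Hol f -> Hol g -> Hol (fun z => f z * g z)%C.
Proof.
  rewrite !Hol_cdiff. intros Hf Hg z Hz.
  destruct (Hf z Hz) as [l Hl], (Hg z Hz) as [m Hm]. eexists. exact (cdiff_mult f g z l m Hl Hm).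
Qed.

Lemma Hol_opp (f : C -> C) : Hol f -> Hol (fun z => - f z)%C.
Proof.
  intros Hf. apply Hol_ext with (fun z => RtoC (-1) * f z)%C.
  - intros z _. apply injective_projections; simpl; ring.
  - apply Hol_mult; [apply Hol_const|exact Hf].
Qed.

Lemma Hol_minus (f g : C -> C) : Hol f -> Hol g -> Hol (fun z => f z - g z)%C.
Proof. intros Hf Hg. apply Hol_plus; [exact Hf|now apply Hol_opp]. Qed.

Lemma Hol_inv (f : C -> C) :
  Hol f -> (forall z, inD z -> f z <> 0%C) -> Hol (fun z => / f z)%C.
Proof.
  rewrite !Hol_cdiff. intros Hf H0 z Hz. destruct (Hf z Hz) as [l Hl].
  eexists. apply (cdiff_comp (fun w => / w)%C f); [apply cdiff_inv; auto|exact Hl].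
Qed.

Lemma Hol_div (f g : C -> C) : Hol f -> Hol g ->
  (forall z, inD z -> g z <> 0%C) -> Hol (fun z => f z / g z)%C.
Proof. intros Hf Hg H0. apply Hol_mult; [exact Hf|now apply Hol_inv]. Qed.

Lemma Hol_pow (f : C -> C) (n : nat) : Hol f -> Hol (fun z => f z ^ n)%C.
Proof.
  intros Hf. induction n as [|n IH]; [exact (Hol_const 1)|].
  exact (Hol_mult _ _ Hf IH).
Qed.

Lemma Hol_comp (f g : C -> C) :
  Hol f -> Hol g -> (forall z, inD z -> inD (g z)) -> Hol (fun z => f (g z)).
Proof.
  rewrite !Hol_cdiff. intros Hf Hg H z Hz.
  destruct (Hg z Hz) as [m Hm], (Hf (g z) (H z Hz)) as [l Hl].
  eexists. apply cdiff_comp; eassumption.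
Qed.

Lemma cdiff_continuous (f : C -> C) (z l : C) (eps : R) :
  cdiff f z l -> 0 < eps ->
  exists del, 0 < del /\ forall w, Cmod (w - z) < del -> Cmod (f w - f z) <= eps.
Proof.
  rewrite cdiff_eps. intros H He. destruct (H 1 Rlt_0_1) as [d [Hd K]].
  assert (HL := Cmod_ge_0 l).
  exists (Rmin d (eps / (1 + Cmod l))). split.
  { apply Rmin_glb_lt; [exact Hd|]. apply Rdiv_lt_0_compat; lra. }
  intros w Hw.
  specialize (K w (Rlt_le_trans _ _ _ Hw (Rmin_l _ _))).
  assert (H2 := Rlt_le_trans _ _ _ Hw (Rmin_r _ _)).
  replace (f w - f z)%C with ((f w - f z - l * (w - z)) + l * (w - z))%C by ring.
  eapply Rle_trans; [apply Cmod_triangle|]. rewrite Cmod_mult.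
  apply Rmult_lt_compat_r with (r := 1 + Cmod l) in H2; [|lra].
  unfold Rdiv in H2. rewrite Rmult_assoc, Rinv_l in H2 by lra. nra.
Qed.

(** * Goursat's theorem *)

Lemma Cmod_le_sum (z : C) : Cmod z <= Rabs (fst z) + Rabs (snd z).
Proof.
  destruct z as [x y]. simpl.
  replace (x, y) with (RtoC x + Ci * RtoC y)%C
    by (apply injective_projections; simpl; ring).
  eapply Rle_trans; [apply Cmod_triangle|].
  rewrite Cmod_mult, Cmod_Ci, !Cmod_R. lra.
Qed.

Lemma Rabs_fst_le (z : C) : Rabs (fst z) <= Cmod z.
Proof. exact (Rle_trans _ _ _ (Rmax_l _ _) (Rmax_Cmod z)). Qed.

Lemma Rabs_snd_le (z : C) : Rabs (snd z) <= Cmod z.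
Proof. exact (Rle_trans _ _ _ (Rmax_r _ _) (Rmax_Cmod z)). Qed.

(** * The complex exponential and its derivative *)

Definition cexp (z : C) : C := (exp (fst z) * cos (snd z), exp (fst z) * sin (snd z)).

Lemma cexp_plus (z w : C) : cexp (z + w)%C = (cexp z * cexp w)%C.
Proof.
  destruct z as [x y], w as [u v]. unfold cexp. simpl.
  rewrite exp_plus, cos_plus, sin_plus.
  apply injective_projections; simpl; ring.
Qed.

Lemma Cmod_cexp (z : C) : Cmod (cexp z) = exp (fst z).
Proof.
  unfold Cmod, cexp; simpl fst; simpl snd.
  replace ((exp (fst z) * cos (snd z)) ^ 2 + (exp (fst z) * sin (snd z)) ^ 2)
    with (Rsqr (exp (fst z)) * (Rsqr (sin (snd z)) + Rsqr (cos (snd z))))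
    by (unfold Rsqr; ring).
  rewrite sin2_cos2, Rmult_1_r. apply sqrt_Rsqr. left. apply exp_pos.
Qed.

Lemma derivable_pt_lim_error (f : R -> R) (x l : R) :
  derivable_pt_lim f x l -> forall eps, 0 < eps ->
  exists del, 0 < del /\ forall h, Rabs h < del ->
    Rabs (f (x + h) - f x - l * h) <= eps * Rabs h.
Proof.
  intros H e He. destruct (H e He) as [d K]. exists d. split; [apply cond_pos|].
  intros h Hh. destruct (Req_dec h 0) as [->|H0].
  - rewrite Rplus_0_r. replace (f x - f x - l * 0) with 0 by ring.
    rewrite Rabs_R0. lra.
  - specialize (K h H0 Hh).
    replace (f (x + h) - f x - l * h) with (((f (x + h) - f x) / h - l) * h) by (field; auto).
    rewrite Rabs_mult. apply Rmult_le_compat_r; [apply Rabs_pos|lra].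
Qed.

Lemma cexp_error (eps : R) : 0 < eps ->
  exists del, 0 < del /\ forall h, Cmod h < del ->
    Cmod (cexp h - 1 - h)%C <= eps * Cmod h.
Proof.
  (* The real and imaginary parts of the error turn out to be at most 3 and 5 times [eta * m], hence
     the division by 8. The cap at 1 keeps exp x bounded. *)
  intros He. set (eta := Rmin (eps / 8) 1).
  assert (He0 : 0 < eta) by (apply Rmin_glb_lt; lra).
  assert (He1 : eta <= 1) by apply Rmin_r.
  assert (He8 : 8 * eta <= eps) by (assert (T := Rmin_l (eps / 8) 1); fold eta in T; lra).
  destruct (derivable_pt_lim_error exp 0 (exp 0) (derivable_pt_lim_exp 0) eta He0) as [d1 [Hd1 K1]].
  destruct (derivable_pt_lim_error cos 0 (- sin 0) (derivable_pt_lim_cos 0) eta He0) as [d2 [Hd2 K2]].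
  destruct (derivable_pt_lim_error sin 0 (cos 0) (derivable_pt_lim_sin 0) eta He0) as [d3 [Hd3 K3]].
  exists (Rmin (Rmin d1 d2) (Rmin d3 eta)). split.
  { apply Rmin_glb_lt; (apply Rmin_glb_lt; [assumption|assumption]). }
  intros h Hh.
  assert (Hx := Rabs_fst_le h). assert (Hy := Rabs_snd_le h).
  assert (Hm := Cmod_ge_0 h). set (m := Cmod h) in *.
  assert (L1 : m < d1) by (eapply Rlt_le_trans; [exact Hh|]; eapply Rle_trans; [apply Rmin_l|apply Rmin_l]).
  assert (L2 : m < d2) by (eapply Rlt_le_trans; [exact Hh|]; eapply Rle_trans; [apply Rmin_l|apply Rmin_r]).
  assert (L3 : m < d3) by (eapply Rlt_le_trans; [exact Hh|]; eapply Rle_trans; [apply Rmin_r|apply Rmin_l]).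
  assert (L4 : m < eta) by (eapply Rlt_le_trans; [exact Hh|]; eapply Rle_trans; [apply Rmin_r|apply Rmin_r]).
  clear Hh.
  destruct h as [x y]. simpl in Hx, Hy. clearbody m.
  specialize (K1 x ltac:(lra)). specialize (K2 y ltac:(lra)). specialize (K3 y ltac:(lra)).
  rewrite Rplus_0_l in K1, K2, K3.
  rewrite exp_0, Rmult_1_l in K1. rewrite cos_0, sin_0, Ropp_0, Rmult_0_l, Rminus_0_r in K2.
  rewrite sin_0, cos_0, Rmult_1_l, Rminus_0_r in K3.
  assert (Hc : Rabs (cos y) <= 1) by (apply Rabs_le; generalize (COS_bound y); lra).
  eapply Rle_trans; [apply Cmod_le_sum|]. simpl.
  replace (exp x * cos y + - (1) + - x)
    with ((exp x - 1 - x) * cos y + (1 + x) * (cos y - 1)) by ring.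
  replace (exp x * sin y + - 0 + - y) with (exp x * (sin y - y) + (exp x - 1) * y) by ring.
  assert (E1 : Rabs (exp x - 1 - x) <= eta * m) by (eapply Rle_trans; [exact K1|]; apply Rmult_le_compat_l; lra).
  assert (E2 : Rabs (cos y - 1) <= eta * m) by (eapply Rle_trans; [exact K2|]; apply Rmult_le_compat_l; lra).
  assert (E3 : Rabs (sin y - y) <= eta * m) by (eapply Rle_trans; [exact K3|]; apply Rmult_le_compat_l; lra).
  assert (E4 : Rabs (exp x - 1) <= 2 * m).
  { replace (exp x - 1) with ((exp x - 1 - x) + x) by ring.
    eapply Rle_trans; [apply Rabs_triang|]. nra. }
  assert (E5 : Rabs (exp x) <= 3).
  { replace (exp x) with ((exp x - 1) + 1) by ring.
    eapply Rle_trans; [apply Rabs_triang|]. rewrite Rabs_R1. lra. }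
  assert (E6 : Rabs (1 + x) <= 2).
  { eapply Rle_trans; [apply Rabs_triang|]. rewrite Rabs_R1. lra. }
  assert (A1 : Rabs ((exp x - 1 - x) * cos y + (1 + x) * (cos y - 1)) <= 3 * (eta * m)).
  { eapply Rle_trans; [apply Rabs_triang|]. rewrite !Rabs_mult.
    assert (Rabs (exp x - 1 - x) * Rabs (cos y) <= eta * m * 1)
      by (apply Rmult_le_compat; auto using Rabs_pos).
    assert (Rabs (1 + x) * Rabs (cos y - 1) <= 2 * (eta * m))
      by (apply Rmult_le_compat; auto using Rabs_pos).
    lra. }
  assert (A2 : Rabs (exp x * (sin y - y) + (exp x - 1) * y) <= 5 * (eta * m)).
  { eapply Rle_trans; [apply Rabs_triang|]. rewrite !Rabs_mult.
    assert (Rabs (exp x) * Rabs (sin y - y) <= 3 * (eta * m))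
      by (apply Rmult_le_compat; auto using Rabs_pos).
    assert (Rabs (exp x - 1) * Rabs y <= 2 * m * m)
      by (apply Rmult_le_compat; auto using Rabs_pos).
    nra. }
  nra.
Qed.

Lemma cdiff_cexp (z : C) : cdiff cexp z (cexp z).
Proof.
  apply cdiff_eps. intros e He.
  assert (Hm := exp_pos (fst z)). rewrite <- Cmod_cexp in Hm.
  destruct (cexp_error (e / Cmod (cexp z))) as [d [Hd K]].
  { apply Rdiv_lt_0_compat; lra. }
  exists d. split; [exact Hd|]. intros w Hw. specialize (K _ Hw).
  assert (E : cexp w = (cexp z * cexp (w - z))%C).
  { rewrite <- cexp_plus. f_equal. ring. }
  rewrite E.
  replace (cexp z * cexp (w - z) - cexp z - cexp z * (w - z))%C
    with (cexp z * (cexp (w - z) - 1 - (w - z)))%C by ring.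
  rewrite Cmod_mult.
  apply Rmult_le_compat_l with (r := Cmod (cexp z)) in K; [|lra].
  eapply Rle_trans; [exact K|]. right. field. lra.
Qed.

(** Serves to choose the nested rectangles of [goursat]: [P] is the invariant at stage k and [Q]
    ties each rectangle to its successor. *)
Lemma dependent_choice (X : Type) (P : nat -> X -> Prop) (Q : nat -> X -> X -> Prop) (x0 : X) :
  P 0%nat x0 ->
  (forall k x, P k x -> exists y, P (S k) y /\ Q k x y) ->
  exists u : nat -> X, u 0%nat = x0 /\ (forall k, P k (u k)) /\ forall k, Q k (u k) (u (S k)).
Proof.
  intros H0 H.
  pose (u := nat_rect (fun _ => X) x0
     (fun k x => epsilon (inhabits x) (fun y => P (S k) y /\ Q k x y))).
  assert (HP : forall k, P k (u k)).
  { intros k. induction k as [|k IH]; [exact H0|].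
    exact (proj1 (epsilon_spec (inhabits (u k)) _ (H k (u k) IH))). }
  exists u. split; [reflexivity|split; [exact HP|]].
  intros k. exact (proj2 (epsilon_spec (inhabits (u k)) _ (H k (u k) (HP k)))).
Qed.

Lemma RInt_near_const (f : R -> R) (a b k M : R) :
  a <= b -> ex_RInt f a b -> (forall x, a <= x <= b -> Rabs (f x - k) <= M) ->
  Rabs (RInt f a b - (b - a) * k) <= (b - a) * M.
Proof.
  intros Hab Hf H.
  apply (norm_RInt_le_const (V := R_NormedModule) (fun x => f x - k) a b _ M Hab H).
  apply (is_RInt_minus (V := R_NormedModule) f (fun _ => k)).
  - apply (RInt_correct f), Hf.
  - apply (is_RInt_const (V := R_NormedModule)).
Qed.

(** * Integrals over rectangle boundaries *)

Section Rectangle.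

Variable Phi : C -> C.

Definition differentiable_on (a b c d : R) : Prop :=
  forall s t, a <= s <= b -> c <= t <= d -> exists l, cdiff Phi (s, t) l.

(** The real part of the contour integral of Phi(z) dz around the rectangle, counterclockwise, with
    opposite sides paired. The real part is enough for the mean value argument, and it keeps all
    integrals real. *)
Definition rect_RInt (a b c d : R) : R :=
  RInt (fun s => fst (Phi (s, c)) - fst (Phi (s, d))) a b
  - RInt (fun t => snd (Phi (b, t)) - snd (Phi (a, t))) c d.

Lemma continuous_fst_horizontal (s t : R) (l : C) :
  cdiff Phi (s, t) l -> continuous (fun s => fst (Phi (s, t))) s.
Proof.
  intros H. apply continuity_pt_filterlim. intros e He.
  destruct (cdiff_continuous _ _ _ (e / 2) H) as [d [Hd K]]; [lra|].
  exists d. split; [exact Hd|]. intros x [_ Hx].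
  simpl in *. unfold R_dist in *.
  assert (E : ((x, t) - (s, t))%C = RtoC (x - s))
    by (apply injective_projections; simpl; ring).
  specialize (K (x, t)). rewrite E, Cmod_R in K. specialize (K Hx).
  assert (T := Rabs_fst_le (Phi (x, t) - Phi (s, t))%C). simpl in T.
  unfold Rminus. lra.
Qed.

Lemma continuous_snd_vertical (s t : R) (l : C) :
  cdiff Phi (s, t) l -> continuous (fun t => snd (Phi (s, t))) t.
Proof.
  intros H. apply continuity_pt_filterlim. intros e He.
  destruct (cdiff_continuous _ _ _ (e / 2) H) as [d [Hd K]]; [lra|].
  exists d. split; [exact Hd|]. intros x [_ Hx].
  simpl in *. unfold R_dist in *.
  assert (E : ((s, x) - (s, t))%C = (Ci * RtoC (x - t))%C)
    by (apply injective_projections; simpl; ring).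
  specialize (K (s, x)). rewrite E, Cmod_mult, Cmod_Ci, Rmult_1_l, Cmod_R in K.
  specialize (K Hx).
  assert (T := Rabs_snd_le (Phi (s, x) - Phi (s, t))%C). simpl in T.
  unfold Rminus. lra.
Qed.

Lemma ex_RInt_horizontal (a b c d a' b' t u : R) :
  differentiable_on a b c d -> a <= a' <= b' -> b' <= b -> c <= t <= d -> c <= u <= d ->
  ex_RInt (fun s => fst (Phi (s, t)) - fst (Phi (s, u))) a' b'.
Proof.
  intros H Ha Hb Ht Hu. apply (ex_RInt_continuous (V := R_CompleteNormedModule)).
  intros s. rewrite Rmin_left, Rmax_right by lra. intros Hs.
  destruct (H s t) as [l Hl]; [lra|lra|]. destruct (H s u) as [m Hm]; [lra|lra|].
  apply (continuous_minus (V := R_NormedModule)); eapply continuous_fst_horizontal; eassumption.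
Qed.

Lemma ex_RInt_vertical (a b c d c' d' s u : R) :
  differentiable_on a b c d -> c <= c' <= d' -> d' <= d -> a <= s <= b -> a <= u <= b ->
  ex_RInt (fun t => snd (Phi (s, t)) - snd (Phi (u, t))) c' d'.
Proof.
  intros H Ha Hb Hs Hu. apply (ex_RInt_continuous (V := R_CompleteNormedModule)).
  intros t. rewrite Rmin_left, Rmax_right by lra. intros Ht.
  destruct (H s t) as [l Hl]; [lra|lra|]. destruct (H u t) as [m Hm]; [lra|lra|].
  apply (continuous_minus (V := R_NormedModule)); eapply continuous_snd_vertical; eassumption.
Qed.

Lemma differentiable_on_sub (a b c d a' b' c' d' : R) :
  differentiable_on a b c d -> a <= a' -> b' <= b -> c <= c' -> d' <= d ->
  differentiable_on a' b' c' d'.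
Proof. intros H Ha Hb Hc Hd s t Hs Ht. apply H; lra. Qed.

Lemma rect_RInt_split_horizontal (a m b c d : R) :
  differentiable_on a b c d -> a <= m <= b -> c <= d ->
  rect_RInt a b c d = rect_RInt a m c d + rect_RInt m b c d.
Proof.
  intros H Hm Hcd. unfold rect_RInt.
  rewrite <- (RInt_Chasles (V := R_CompleteNormedModule)
    (fun s => fst (Phi (s, c)) - fst (Phi (s, d))) a m b)
    by (apply (ex_RInt_horizontal a b c d); auto; lra).
  rewrite (RInt_ext (V := R_CompleteNormedModule) (fun t => snd (Phi (b, t)) - snd (Phi (a, t)))
    (fun t => plus (snd (Phi (b, t)) - snd (Phi (m, t))) (snd (Phi (m, t)) - snd (Phi (a, t)))))
    by (intros t _; unfold plus; simpl; ring).
  rewrite (RInt_plus (V := R_CompleteNormedModule))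
    by (apply (ex_RInt_vertical a b c d); auto; lra).
  unfold plus; simpl. ring.
Qed.

Lemma rect_RInt_split_vertical (a b c m d : R) :
  differentiable_on a b c d -> a <= b -> c <= m <= d ->
  rect_RInt a b c d = rect_RInt a b c m + rect_RInt a b m d.
Proof.
  intros H Hab Hm. unfold rect_RInt.
  rewrite <- (RInt_Chasles (V := R_CompleteNormedModule)
    (fun t => snd (Phi (b, t)) - snd (Phi (a, t))) c m d)
    by (apply (ex_RInt_vertical a b c d); auto; lra).
  rewrite (RInt_ext (V := R_CompleteNormedModule) (fun s => fst (Phi (s, c)) - fst (Phi (s, d)))
    (fun s => plus (fst (Phi (s, c)) - fst (Phi (s, m))) (fst (Phi (s, m)) - fst (Phi (s, d)))))
    by (intros t _; unfold plus; simpl; ring).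
  rewrite (RInt_plus (V := R_CompleteNormedModule))
    by (apply (ex_RInt_horizontal a b c d); auto; lra).
  unfold plus; simpl. ring.
Qed.

(* The first-order part of [Phi] at a point of the rectangle contributes nothing,
   so only the error term of the differential is left. *)
Lemma rect_RInt_small (a b c d s0 t0 eps : R) (l : C) :
  differentiable_on a b c d -> a <= s0 <= b -> c <= t0 <= d -> 0 <= eps ->
  (forall s t, a <= s <= b -> c <= t <= d ->
    Cmod (Phi (s, t) - Phi (s0, t0) - l * ((s, t) - (s0, t0)))
      <= eps * Cmod ((s, t) - (s0, t0))) ->
  Rabs (rect_RInt a b c d) <= 2 * eps * (b - a + (d - c)) ^ 2.
Proof.
  intros H Hs0 Ht0 He K.
  set (D := b - a + (d - c)).
  assert (K' : forall s t, a <= s <= b -> c <= t <= d ->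
    Cmod (Phi (s, t) - Phi (s0, t0) - l * ((s, t) - (s0, t0))) <= eps * D).
  { intros s t Hs Ht. eapply Rle_trans; [apply K; assumption|].
    apply Rmult_le_compat_l; [exact He|].
    eapply Rle_trans; [apply Cmod_le_sum|]. simpl. unfold D.
    apply Rplus_le_compat; apply Rabs_le; lra. }
  assert (I1 : Rabs (RInt (fun s => fst (Phi (s, c)) - fst (Phi (s, d))) a b
      - (b - a) * (snd l * (d - c))) <= (b - a) * (2 * (eps * D))).
  { apply RInt_near_const; [lra|apply (ex_RInt_horizontal a b c d); auto; lra|].
    intros s Hs.
    assert (T1 := Rabs_fst_le (Phi (s, c) - Phi (s0, t0) - l * ((s, c) - (s0, t0)))%C).
    assert (T2 := Rabs_fst_le (Phi (s, d) - Phi (s0, t0) - l * ((s, d) - (s0, t0)))%C).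
    assert (K1 := K' s c Hs ltac:(lra)). assert (K2 := K' s d Hs ltac:(lra)).
    set (u := fst (Phi (s, c) - Phi (s0, t0) - l * ((s, c) - (s0, t0)))%C) in *.
    set (v := fst (Phi (s, d) - Phi (s0, t0) - l * ((s, d) - (s0, t0)))%C) in *.
    replace (fst (Phi (s, c)) - fst (Phi (s, d)) - snd l * (d - c)) with (u - v)
      by (unfold u, v; simpl; ring).
    eapply Rle_trans; [apply Rabs_triang|]. rewrite Rabs_Ropp. lra. }
  assert (I2 : Rabs (RInt (fun t => snd (Phi (b, t)) - snd (Phi (a, t))) c d
      - (d - c) * (snd l * (b - a))) <= (d - c) * (2 * (eps * D))).
  { apply RInt_near_const; [lra|apply (ex_RInt_vertical a b c d); auto; lra|].
    intros t Ht.
    assert (T1 := Rabs_snd_le (Phi (b, t) - Phi (s0, t0) - l * ((b, t) - (s0, t0)))%C).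
    assert (T2 := Rabs_snd_le (Phi (a, t) - Phi (s0, t0) - l * ((a, t) - (s0, t0)))%C).
    assert (K1 := K' b t ltac:(lra) Ht). assert (K2 := K' a t ltac:(lra) Ht).
    set (u := snd (Phi (b, t) - Phi (s0, t0) - l * ((b, t) - (s0, t0)))%C) in *.
    set (v := snd (Phi (a, t) - Phi (s0, t0) - l * ((a, t) - (s0, t0)))%C) in *.
    replace (snd (Phi (b, t)) - snd (Phi (a, t)) - snd l * (b - a)) with (u - v)
      by (unfold u, v; simpl; ring).
    eapply Rle_trans; [apply Rabs_triang|]. rewrite Rabs_Ropp. lra. }
  unfold rect_RInt. apply Rabs_le_between in I1. apply Rabs_le_between in I2.
  apply Rabs_le. unfold D in *. split; nra.
Qed.

Lemma nested_interval_point (u : nat -> R) (w : R) :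
  0 <= w -> (forall k, u k <= u (S k) <= u k + w / 2 ^ S k) ->
  exists s, forall k, u k <= s <= u k + w / 2 ^ k.
Proof.
  intros Hw H.
  assert (Hp : forall k, 0 < 2 ^ k) by (intros; apply pow_lt; lra).
  (* The halved steps sum to a geometric progression, so from stage k on the left end never passes
     [u k + w / 2 ^ k]. The common point is the supremum of the left ends. *)
  assert (Hup : forall k j, u (j + k)%nat <= u k + w / 2 ^ k - w / 2 ^ (j + k)).
  { intros k j. induction j as [|j IH]; simpl Nat.add; [lra|].
    destruct (H (j + k)%nat) as [_ T].
    replace (w / 2 ^ (j + k)) with (w / 2 ^ S (j + k) + w / 2 ^ S (j + k)) in IH.
    - lra.
    - simpl. field. apply Rgt_not_eq, Hp. }
  assert (Hmono : forall k j, u k <= u (j + k)%nat).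
  { intros k j. induction j as [|j IH]; simpl Nat.add; [lra|]. generalize (H (j + k)%nat). lra. }
  assert (Hpos : forall k, 0 <= w / 2 ^ k)
    by (intros k; apply Rmult_le_pos; [exact Hw|left; apply Rinv_0_lt_compat, Hp]).
  assert (Hall : forall i k, u i <= u k + w / 2 ^ k).
  { intros i k. destruct (Nat.le_ge_cases i k) as [L|L].
    - replace k with ((k - i) + i)%nat by lia.
      generalize (Hmono i (k - i)%nat) (Hpos ((k - i) + i)%nat). lra.
    - replace i with ((i - k) + k)%nat by lia.
      generalize (Hup k (i - k)%nat) (Hpos ((i - k) + k)%nat). lra. }
  destruct (completeness (fun x => exists k, x = u k)) as [s [Hs1 Hs2]].
  - exists (u 0%nat + w / 2 ^ 0). intros x [k ->]. apply Hall.
  - exists (u 0%nat), 0%nat. reflexivity.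
  - exists s. intros k. split; [apply Hs1; now exists k|].
    apply Hs2. intros x [i ->]. apply Hall.
Qed.

(** Bisection: of the four quarters one keeps at least a quarter of the integral. The chosen
    rectangles shrink to a point, where differentiability makes the integral smaller than any fixed
    multiple of the squared size. *)
Theorem goursat (a b c d : R) :
  a < b -> c < d -> differentiable_on a b c d -> rect_RInt a b c d = 0.
Proof.
  intros Hab Hcd H. set (w := b - a). set (h := d - c).
  destruct (Req_dec (rect_RInt a b c d) 0) as [|Hne]; [assumption|exfalso].
  (* Halved so that the strict inequality in the invariant [P] already holds at stage 0. *)
  set (mu := Rabs (rect_RInt a b c d) / 2).
  assert (Hmu : 0 < mu) by (unfold mu; generalize (Rabs_pos_lt _ Hne); lra).
  assert (Hp : forall k, 0 < 2 ^ k) by (intros; apply pow_lt; lra).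
  assert (Hp4 : forall k, 0 < 4 ^ k) by (intros; apply pow_lt; lra).
  assert (Hw : 0 < w) by (unfold w; lra). assert (Hh : 0 < h) by (unfold h; lra).
  pose (P := fun (k : nat) (p : R * R) =>
    a <= fst p /\ fst p + w / 2 ^ k <= b /\ c <= snd p /\ snd p + h / 2 ^ k <= d /\
    mu / 4 ^ k < Rabs (rect_RInt (fst p) (fst p + w / 2 ^ k) (snd p) (snd p + h / 2 ^ k))).
  pose (Q := fun (k : nat) (p q : R * R) =>
    fst p <= fst q <= fst p + w / 2 ^ S k /\ snd p <= snd q <= snd p + h / 2 ^ S k).
  destruct (dependent_choice (R * R) P Q (a, c)) as [u [_ [HP HQ]]].
  { unfold P; simpl. unfold Rdiv. rewrite Rinv_1, !Rmult_1_r.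
    replace (a + w) with b by (unfold w; ring). replace (c + h) with d by (unfold h; ring).
    repeat split; try lra. unfold mu in *. lra. }
  { intros k [x y] [P1 [P2 [P3 [P4 P5]]]]. simpl fst in *. simpl snd in *.
    set (w' := w / 2 ^ S k) in *. set (h' := h / 2 ^ S k) in *.
    assert (Ew : w / 2 ^ k = w' + w') by (unfold w'; simpl; field; apply Rgt_not_eq, Hp).
    assert (Eh : h / 2 ^ k = h' + h') by (unfold h'; simpl; field; apply Rgt_not_eq, Hp).
    assert (Em : mu / 4 ^ k = 4 * (mu / 4 ^ S k)) by (simpl; field; apply Rgt_not_eq, Hp4).
    assert (Hw' : 0 < w') by (apply Rdiv_lt_0_compat; auto).
    assert (Hh' : 0 < h') by (apply Rdiv_lt_0_compat; auto).
    rewrite Ew, Eh, Em in *. clear Ew Eh Em.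
    assert (D : differentiable_on x (x + (w' + w')) y (y + (h' + h')))
      by (apply (differentiable_on_sub a b c d); auto).
    rewrite (rect_RInt_split_horizontal x (x + w')) in P5; [|exact D|lra|lra].
    rewrite (rect_RInt_split_vertical x (x + w') y (y + h')) in P5;
      [|apply (differentiable_on_sub _ _ _ _ _ _ _ _ D); lra|lra|lra].
    rewrite (rect_RInt_split_vertical (x + w') _ y (y + h')) in P5;
      [|apply (differentiable_on_sub _ _ _ _ _ _ _ _ D); lra|lra|lra].
    replace (x + (w' + w')) with (x + w' + w') in P5 by ring.
    replace (y + (h' + h')) with (y + h' + h') in P5 by ring.
    assert (Hstep : forall q1 q2, (q1 = x \/ q1 = x + w') -> (q2 = y \/ q2 = y + h') ->
      mu / 4 ^ S k < Rabs (rect_RInt q1 (q1 + w') q2 (q2 + h')) ->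
      exists q, P (S k) q /\ Q k (x, y) q).
    { intros q1 q2 Hq1 Hq2 Hq. exists (q1, q2). unfold P, Q. simpl fst; simpl snd.
      fold w' h'. destruct Hq1, Hq2; subst; repeat split; try lra; exact Hq. }
    destruct (Rlt_le_dec (mu / 4 ^ S k) (Rabs (rect_RInt x (x + w') y (y + h')))) as [L1|L1];
      [apply (Hstep x y); auto|].
    destruct (Rlt_le_dec (mu / 4 ^ S k) (Rabs (rect_RInt x (x + w') (y + h') (y + h' + h')))) as [L2|L2];
      [apply (Hstep x (y + h')); auto|].
    destruct (Rlt_le_dec (mu / 4 ^ S k) (Rabs (rect_RInt (x + w') (x + w' + w') y (y + h')))) as [L3|L3];
      [apply (Hstep (x + w') y); auto|].
    destruct (Rlt_le_dec (mu / 4 ^ S k) (Rabs (rect_RInt (x + w') (x + w' + w') (y + h') (y + h' + h')))) as [L4|L4];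
      [apply (Hstep (x + w') (y + h')); auto|].
    exfalso. revert P5. apply Rle_not_lt.
    eapply Rle_trans; [apply Rabs_triang|].
    eapply Rle_trans; [apply Rplus_le_compat; apply Rabs_triang|]. lra. }
  destruct (nested_interval_point (fun k => fst (u k)) w) as [s Hs];
    [lra|intros k; apply HQ|].
  destruct (nested_interval_point (fun k => snd (u k)) h) as [t Ht];
    [lra|intros k; apply HQ|].
  assert (Hst : a <= s <= b /\ c <= t <= d).
  { destruct (HP 0%nat) as [A1 [A2 [A3 [A4 _]]]]. generalize (Hs 0%nat) (Ht 0%nat). lra. }
  destruct (H s t (proj1 Hst) (proj2 Hst)) as [l Hl].
  (* Makes the bound of [rect_RInt_small] at stage k, 2 eps ((w + h) / 2^k)^2, exactly [mu / 4 ^ k],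
     which contradicts the invariant once the rectangle fits in the ball of radius [del]. *)
  set (eps := mu / (2 * (w + h) ^ 2)).
  assert (Hwh : 0 < (w + h) ^ 2) by (apply pow_lt; lra).
  assert (Heps : 0 < eps) by (apply Rdiv_lt_0_compat; lra).
  destruct (proj1 (cdiff_eps _ _ _) Hl eps Heps) as [del [Hdel K]].
  destruct (nfloor_ex ((w + h) / del)) as [k [_ Hk]].
  { left. apply Rdiv_lt_0_compat; [lra|exact Hdel]. }
  assert (Hk2 : (w + h) / 2 ^ k < del).
  { apply Rmult_lt_reg_r with (2 ^ k); [apply Hp|]. unfold Rdiv.
    rewrite Rmult_assoc, Rinv_l, Rmult_1_r by (apply Rgt_not_eq, Hp).
    apply Rmult_lt_compat_r with (r := del) in Hk; [|exact Hdel].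
    unfold Rdiv in Hk. rewrite Rmult_assoc, Rinv_l, Rmult_1_r in Hk by lra.
    assert (T : INR k + 1 <= 2 ^ k).
    { clear. induction k as [|k IH]; [simpl; lra|]. rewrite S_INR. simpl pow.
      generalize (pos_INR k). lra. }
    nra. }
  destruct (HP k) as [P1 [P2 [P3 [P4 P5]]]]. specialize (Hs k). specialize (Ht k). simpl in Hs, Ht.
  set (x := fst (u k)) in *. set (y := snd (u k)) in *.
  assert (Hsum : (w + h) / 2 ^ k = w / 2 ^ k + h / 2 ^ k) by (unfold Rdiv; ring).
  revert P5. apply Rle_not_lt.
  eapply Rle_trans; [apply (rect_RInt_small _ _ _ _ s t eps l)|].
  - apply (differentiable_on_sub a b c d); auto.
  - exact Hs.
  - exact Ht.
  - lra.
  - intros s' t' Hs' Ht'. apply K. eapply Rle_lt_trans; [apply Cmod_le_sum|]. simpl.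
    eapply Rle_lt_trans; [|exact Hk2]. rewrite Hsum.
    apply Rplus_le_compat; apply Rabs_le; lra.
  - right. unfold eps.
    replace (4 ^ k) with (2 ^ k * 2 ^ k) by (rewrite <- Rpow_mult_distr; f_equal; ring).
    field. split; [apply Rgt_not_eq, Hp|lra].
Qed.

End Rectangle.

(** * Mean values over circles *)

Lemma cexp_lt_inD (s t : R) : s < 0 -> inD (cexp (s, t)).
Proof.
  intros Hs. unfold inD. rewrite Cmod_cexp. simpl. rewrite <- exp_0. now apply exp_increasing.
Qed.

(** One-sided mean value property. In the coordinate log z, [goursat] says that the integrals of Re
    H over the circle of radius [rho] and over a tiny circle agree. The first is nonnegative, while
    a negative value at 0 would make the second negative by continuity. *)
Lemma Re_nonneg_center (H : C -> C) (rho : R) :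
  Hol H -> 0 < rho < 1 -> (forall z, Cmod z = rho -> 0 <= Re (H z)) -> 0 <= Re (H 0%C).
Proof.
  intros HH Hrho Hpos.
  destruct (Rle_lt_dec 0 (Re (H 0%C))) as [|Hneg]; [assumption|exfalso].
  rewrite Hol_cdiff in HH.
  assert (HD0 : inD 0%C) by (unfold inD; rewrite Cmod_0; lra).
  destruct (HH _ HD0) as [l Hl].
  destruct (cdiff_continuous _ _ _ (- Re (H 0%C) / 2) Hl) as [del [Hdel K]]; [lra|].
  (* The right side of the rectangle is mapped to the circle of radius [rho]. The left side goes to
     a circle so small that H differs there from H(0) by at most half of |Re H(0)|. *)
  set (b := ln rho). set (a := Rmin (b - 1) (ln del - 1)).
  assert (Hb : b < 0) by (unfold b; rewrite <- ln_1; apply ln_increasing; lra).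
  assert (Hab : a < b) by (unfold a; generalize (Rmin_l (b - 1) (ln del - 1)); lra).
  assert (Had : exp a < del).
  { rewrite <- (exp_ln del Hdel). apply exp_increasing.
    unfold a; generalize (Rmin_r (b - 1) (ln del - 1)); lra. }
  assert (Hpi := PI_RGT_0).
  pose (Phi := fun z => (Ci * H (cexp z))%C).
  assert (D : differentiable_on Phi a b 0 (2 * PI)).
  { intros s t Hs _. destruct (HH (cexp (s, t))) as [m Hm]; [apply cexp_lt_inD; lra|].
    eexists. apply (cdiff_mult (fun _ => Ci) (fun z => H (cexp z))); [apply cdiff_const|].
    apply (cdiff_comp H cexp); [exact Hm|apply cdiff_cexp]. }
  assert (G := goursat Phi a b 0 (2 * PI) Hab ltac:(lra) D). unfold rect_RInt in G.
  (* The two horizontal sides cancel because [cexp] has period 2 pi i. The factor [Ci] in [Phi]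
     makes the vertical sides carry Re H. *)
  rewrite (RInt_ext (V := R_CompleteNormedModule)
    (fun s => fst (Phi (s, 0)) - fst (Phi (s, 2 * PI))) (fun _ => 0)) in G.
  2:{ intros s _. unfold Phi, cexp. simpl fst; simpl snd.
      rewrite sin_0, cos_0, sin_2PI, cos_2PI. apply Rminus_diag_eq; reflexivity. }
  rewrite (RInt_const (V := R_CompleteNormedModule)) in G.
  assert (L : RInt (fun _ => - Re (H 0%C) / 2) 0 (2 * PI)
    <= RInt (fun t => snd (Phi (b, t)) - snd (Phi (a, t))) 0 (2 * PI)).
  { apply RInt_le; [lra|apply ex_RInt_const|apply (ex_RInt_vertical Phi a b 0 (2 * PI)); auto; lra|].
    intros t _.
    assert (E : forall z, snd (Phi z) = Re (H (cexp z))) by (intros z; unfold Phi; simpl; unfold Re; ring).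
    rewrite !E.
    assert (0 <= Re (H (cexp (b, t)))) by (apply Hpos; rewrite Cmod_cexp; simpl; unfold b; apply exp_ln; lra).
    assert (T : Cmod (H (cexp (a, t)) - H 0)%C <= - Re (H 0%C) / 2).
    { apply K. replace (cexp (a, t) - 0)%C with (cexp (a, t)) by ring.
      rewrite Cmod_cexp. exact Had. }
    assert (T2 := Rle_trans _ _ _ (Rabs_fst_le _) T). apply Rabs_le_between in T2.
    simpl in T2. unfold Re in *. lra. }
  rewrite (RInt_const (V := R_CompleteNormedModule)) in L.
  unfold scal in L, G; simpl in L, G; unfold mult in L, G; simpl in L, G.
  assert (0 < (2 * PI) * (- Re (H 0%C) / 2)) by (apply Rmult_lt_0_compat; lra).
  lra.
Qed.

(** * Power series *)

(** The upper limit is excluded, unlike in [sum_n]: the empty sum is then the base case of the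
    telescoping identities, and the passage to [sum_n] shifts the index by one. *)
Fixpoint csum (u : nat -> C) (n : nat) : C :=
  match n with O => 0%C | S m => (csum u m + u m)%C end.

Fixpoint rsum (u : nat -> R) (n : nat) : R :=
  match n with O => 0 | S m => rsum u m + u m end.

Lemma csum_ext (u v : nat -> C) (n : nat) :
  (forall k, (k < n)%nat -> u k = v k) -> csum u n = csum v n.
Proof.
  induction n as [|n IH]; intros H; simpl; [reflexivity|].
  rewrite IH by (intros; apply H; lia). rewrite H by lia. reflexivity.
Qed.

Lemma rsum_le (u v : nat -> R) (n : nat) :
  (forall k, (k < n)%nat -> u k <= v k) -> rsum u n <= rsum v n.
Proof.
  induction n as [|n IH]; intros H; simpl; [lra|].
  apply Rplus_le_compat; [apply IH; intros; apply H|apply H]; lia.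
Qed.

Lemma rsum_scal (c : R) (u : nat -> R) (n : nat) :
  rsum (fun k => c * u k) n = c * rsum u n.
Proof. induction n as [|n IH]; simpl; [ring|rewrite IH; ring]. Qed.

Lemma rsum_pos (u : nat -> R) (n : nat) : (forall k, 0 <= u k) -> 0 <= rsum u n.
Proof. intros H. induction n as [|n IH]; simpl; [lra|generalize (H n); lra]. Qed.

Lemma rsum_mono (u : nat -> R) (n m : nat) :
  (forall k, 0 <= u k) -> (n <= m)%nat -> rsum u n <= rsum u m.
Proof. intros H. induction 1 as [|m _ IH]; simpl; [lra|generalize (H m); lra]. Qed.

Lemma rsum_geometric (q : R) (n : nat) : 0 <= q < 1 -> rsum (fun k => q ^ k) n <= / (1 - q).
Proof.
  intros Hq.
  assert (E : rsum (fun k => q ^ k) n * (1 - q) = 1 - q ^ n).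
  { induction n as [|n IH]; simpl; [ring|].
    rewrite Rmult_plus_distr_r, IH. ring. }
  apply Rmult_le_reg_r with (1 - q); [lra|]. rewrite E, Rinv_l by lra.
  generalize (pow_le q n (proj1 Hq)). lra.
Qed.

Lemma csum_split_first (u : nat -> C) (n : nat) :
  csum u (S n) = (u 0%nat + csum (fun k => u (S k)) n)%C.
Proof.
  induction n as [|n IH]; [simpl; ring|].
  change (csum u (S (S n))) with (csum u (S n) + u (S n))%C. rewrite IH. simpl. ring.
Qed.

Lemma csum_scal (c : C) (u : nat -> C) (n : nat) :
  csum (fun k => c * u k)%C n = (c * csum u n)%C.
Proof. induction n as [|n IH]; simpl; [ring|rewrite IH; ring]. Qed.

Lemma csum_plus (u v : nat -> C) (n : nat) :
  csum (fun k => u k + v k)%C n = (csum u n + csum v n)%C.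
Proof. induction n as [|n IH]; simpl; [ring|rewrite IH; ring]. Qed.

Lemma Cmod_csum_le (u : nat -> C) (v : nat -> R) (n : nat) :
  (forall k, Cmod (u k) <= v k) -> Cmod (csum u n) <= rsum v n.
Proof.
  intros H. induction n as [|n IH]; simpl; [rewrite Cmod_0; lra|].
  eapply Rle_trans; [apply Cmod_triangle|]. generalize (H n). lra.
Qed.

(** * Limits of complex sequences *)

Definition clim (s : nat -> C) (l : C) : Prop :=
  forall eps, 0 < eps -> exists N, forall n, (N <= n)%nat -> Cmod (s n - l) < eps.

Lemma clim_unique (s : nat -> C) (l m : C) : clim s l -> clim s m -> l = m.
Proof.
  intros Hl Hm.
  destruct (Req_dec (Cmod (l - m)) 0) as [E|E].
  - apply Cmod_eq_0 in E. replace l with ((l - m) + m)%C by ring. rewrite E. ring.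
  - exfalso. assert (P : 0 < Cmod (l - m)) by (generalize (Cmod_ge_0 (l - m)); lra).
    destruct (Hl (Cmod (l - m) / 2)) as [N1 H1]; [lra|].
    destruct (Hm (Cmod (l - m) / 2)) as [N2 H2]; [lra|].
    specialize (H1 (N1 + N2)%nat ltac:(lia)). specialize (H2 (N1 + N2)%nat ltac:(lia)).
    assert (T := Cmod_triangle (- (s (N1 + N2)%nat - l)) (s (N1 + N2)%nat - m)).
    rewrite Cmod_opp in T.
    replace (- (s (N1 + N2)%nat - l) + (s (N1 + N2)%nat - m))%C with (l - m)%C in T by ring.
    lra.
Qed.

Lemma clim_ext (s t : nat -> C) (l : C) : (forall n, s n = t n) -> clim s l -> clim t l.
Proof.
  intros E H e He. destruct (H e He) as [N K]. exists N. intros n Hn. rewrite <- E. auto.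
Qed.

Lemma clim_const (c : C) : clim (fun _ => c) c.
Proof.
  intros e He. exists 0%nat. intros n _. replace (c - c)%C with (RtoC 0) by ring.
  now rewrite Cmod_0.
Qed.

Lemma clim_plus (s t : nat -> C) (l m : C) :
  clim s l -> clim t m -> clim (fun n => s n + t n)%C (l + m)%C.
Proof.
  intros Hl Hm e He.
  destruct (Hl (e / 2)) as [N1 H1]; [lra|]. destruct (Hm (e / 2)) as [N2 H2]; [lra|].
  exists (N1 + N2)%nat. intros n Hn.
  specialize (H1 n ltac:(lia)). specialize (H2 n ltac:(lia)).
  replace (s n + t n - (l + m))%C with ((s n - l) + (t n - m))%C by ring.
  eapply Rle_lt_trans; [apply Cmod_triangle|lra].
Qed.

Lemma clim_scal (c : C) (s : nat -> C) (l : C) : clim s l -> clim (fun n => c * s n)%C (c * l)%C.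
Proof.
  intros H e He. assert (Hc := Cmod_ge_0 c).
  destruct (H (e / (1 + Cmod c))) as [N K]; [apply Rdiv_lt_0_compat; lra|].
  exists N. intros n Hn. specialize (K n Hn).
  replace (c * s n - c * l)%C with (c * (s n - l))%C by ring. rewrite Cmod_mult.
  apply Rmult_lt_compat_r with (r := 1 + Cmod c) in K; [|lra].
  unfold Rdiv in K. rewrite Rmult_assoc, Rinv_l, Rmult_1_r in K by lra.
  generalize (Cmod_ge_0 (s n - l)). nra.
Qed.

Lemma clim_succ (s : nat -> C) (l : C) : clim s l -> clim (fun n => s (S n)) l.
Proof.
  intros H e He. destruct (H e He) as [N K]. exists N. intros n Hn. apply K. lia.
Qed.

Lemma clim_pred (s : nat -> C) (l : C) : clim (fun n => s (S n)) l -> clim s l.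
Proof.
  intros H e He. destruct (H e He) as [N K]. exists (S N). intros [|n] Hn; [lia|].
  apply K. lia.
Qed.

Lemma clim_Cmod_le (s : nat -> C) (l : C) (M : R) :
  clim s l -> (forall n, Cmod (s n) <= M) -> Cmod l <= M.
Proof.
  intros H K. destruct (Rle_lt_dec (Cmod l) M) as [|L]; [assumption|exfalso].
  destruct (H (Cmod l - M)) as [N HN]; [lra|]. specialize (HN N (le_n _)).
  assert (T := Cmod_triangle (- (s N - l)) (s N)). rewrite Cmod_opp in T.
  replace (- (s N - l) + s N)%C with l in T by ring. generalize (K N). lra.
Qed.

Lemma pow_small (q K eps : R) : 0 <= q < 1 -> 0 <= K -> 0 < eps ->
  exists N, forall n, (N <= n)%nat -> K * q ^ n < eps.
Proof.
  intros Hq HK He.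
  destruct (pow_lt_1_zero q) with (y := eps / (K + 1)) as [N HN].
  - rewrite Rabs_pos_eq; lra.
  - apply Rdiv_lt_0_compat; lra.
  - exists N. intros n Hn. specialize (HN n Hn).
    assert (Hp := pow_le q n (proj1 Hq)). rewrite Rabs_pos_eq in HN by exact Hp.
    apply Rmult_lt_compat_r with (r := K + 1) in HN; [|lra].
    unfold Rdiv in HN. rewrite Rmult_assoc, Rinv_l, Rmult_1_r in HN by lra. nra.
Qed.

Lemma clim_geometric (s : nat -> C) (l : C) (q K : R) : 0 <= q < 1 -> 0 <= K ->
  (forall n, Cmod (s n - l) <= K * q ^ n) -> clim s l.
Proof.
  intros Hq HK H e He. destruct (pow_small q K e Hq HK He) as [N HN].
  exists N. intros n Hn. eapply Rle_lt_trans; [apply H|]. auto.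
Qed.

Lemma sum_n_csum (u : nat -> C) (n : nat) :
  @sum_n C_AbelianMonoid u n = csum u (S n).
Proof.
  induction n as [|n IH].
  - rewrite sum_O. simpl. ring.
  - rewrite sum_Sn, IH. reflexivity.
Qed.

Lemma is_series_clim (u : nat -> C) (l : C) :
  @is_series C_AbsRing C_NormedModule u l <-> clim (csum u) l.
Proof.
  split.
  - intros H. apply clim_pred. intros e He.
    assert (H' := proj1 (filterlim_locally (U := C_UniformSpace) _ l) H).
    (* Balls of the product uniform structure on C are squares, so passing to [Cmod] costs a factor
       sqrt 2. *)
    assert (Hs : 0 < e / sqrt 2) by (apply Rdiv_lt_0_compat; [lra|apply Rlt_sqrt2_0]).
    destruct (H' (mkposreal _ Hs)) as [N K]. exists N. intros n Hn.
    specialize (K n Hn). apply C_NormedModule_mixin_compat2 in K.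
    simpl pos in K.
    replace (sqrt 2 * (e / sqrt 2)) with e in K by (field; apply Rgt_not_eq, Rlt_sqrt2_0).
    rewrite sum_n_csum in K. exact K.
  - intros H. apply clim_succ in H.
    apply (proj2 (filterlim_locally (U := C_UniformSpace) _ l)). intros [e He].
    destruct (H e He) as [N K]. exists N. intros n Hn.
    apply C_NormedModule_mixin_compat1. rewrite sum_n_csum. exact (K n Hn).
Qed.

Lemma clim_csum_exists (u : nat -> C) (q K : R) : 0 <= q < 1 ->
  (forall k, Cmod (u k) <= K * q ^ k) -> exists l, clim (csum u) l.
Proof.
  intros Hq H.
  destruct (@ex_series_le C_AbsRing C_CompleteNormedModule u (fun k => K * q ^ k)) as [l Hl].
  - exact H.
  - apply (ex_series_scal (V := R_NormedModule) K). apply ex_series_geom.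
    rewrite Rabs_pos_eq; lra.
  - exists l. now apply is_series_clim.
Qed.

Lemma pow_n_Cpow (z : C) (k : nat) : @pow_n C_Ring z k = (z ^ k)%C.
Proof. induction k as [|k IH]; [reflexivity|]. simpl. rewrite IH. reflexivity. Qed.

Lemma is_taylor_clim (f : C -> C) (a : nat -> C) :
  is_taylor f a <->
  forall z, inD z -> clim (csum (fun k => a k * z ^ k)%C) (f z).
Proof.
  assert (E : forall z, (fun k => @scal C_Ring C_ModuleSpace (pow_n z k) (a k))
     = (fun k => a k * z ^ k)%C).
  { intros z. apply functional_extensionality. intros k.
    unfold scal; simpl. rewrite pow_n_Cpow. unfold mult; simpl. ring. }
  split; intros H z Hz; specialize (H z Hz).
  - apply is_series_clim. rewrite <- E. exact H.
  - apply is_series_clim in H. rewrite <- E in H. exact H.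
Qed.

(** Radius of convergence at least 1, in the form of Cauchy's estimates. This form is easily checked
    for the tail sums used in division by z - lambda. *)
Definition disc_sequence (a : nat -> C) : Prop :=
  forall rho, 0 <= rho < 1 -> exists M, forall k, Cmod (a k) * rho ^ k <= M.

Lemma is_taylor_disc_sequence (f : C -> C) (a : nat -> C) : is_taylor f a -> disc_sequence a.
Proof.
  intros H rho Hrho. rewrite is_taylor_clim in H.
  assert (Hm : Cmod rho = rho) by (rewrite Cmod_R; apply Rabs_pos_eq; lra).
  specialize (H rho). unfold inD in H. rewrite Hm in H. specialize (H (proj2 Hrho)).
  destruct (@filterlim_bounded C_AbsRing C_NormedModule
    (fun n => csum (fun k => a k * rho ^ k)%C (S n))) as [M HM].
  { exists (f rho). apply is_series_clim in H. unfold is_series in H.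
    eapply filterlim_ext; [|exact H]. intros n. apply sum_n_csum. }
  exists (2 * M). intros k.
  (* A term is the difference of two consecutive partial sums, each bounded by [M]. The empty
     partial sum is outside the bounded family and is treated apart. *)
  assert (E : (Cmod (a k) * rho ^ k)
    = Cmod (csum (fun k => a k * rho ^ k)%C (S k) - csum (fun k => a k * rho ^ k)%C k)).
  { simpl csum. rewrite <- Hm, <- Cmod_pow, Hm, <- Cmod_mult. f_equal. ring. }
  rewrite E. eapply Rle_trans; [apply Cmod_triangle|]. rewrite Cmod_opp.
  assert (H1 := HM k). change norm with Cmod in H1.
  assert (H2 : Cmod (csum (fun k => a k * rho ^ k)%C k) <= M).
  { destruct k as [|k]; [|exact (HM k)].
    simpl. rewrite Cmod_0. exact (Rle_trans _ _ _ (Cmod_ge_0 _) H1). }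
  lra.
Qed.

Lemma disc_sequence_geometric (a : nat -> C) (rho : R) : disc_sequence a -> 0 <= rho < 1 ->
  exists M q, 0 <= M /\ 0 <= q < 1 /\
    forall z k, Cmod z <= rho -> Cmod (a k * z ^ k) <= M * q ^ k.
Proof.
  intros H Hrho. set (t := (1 + rho) / 2).
  assert (Ht : rho < t < 1) by (unfold t; lra).
  destruct (H t) as [M HM]; [lra|]. exists M, (rho / t).
  assert (HM0 : 0 <= M).
  { generalize (HM 0%nat) (Cmod_ge_0 (a 0%nat)). simpl. lra. }
  split; [exact HM0|split].
  - split; [apply Rmult_le_pos; [lra|left; apply Rinv_0_lt_compat; lra]|].
    apply Rmult_lt_reg_r with t; [lra|]. unfold Rdiv. rewrite Rmult_assoc, Rinv_l; lra.
  - intros z k Hz. rewrite Cmod_mult, Cmod_pow.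
    assert (Hp : 0 < t ^ k) by (apply pow_lt; lra).
    assert (E : (rho / t) ^ k = rho ^ k / t ^ k)
      by (unfold Rdiv; rewrite Rpow_mult_distr, pow_inv; reflexivity).
    rewrite E. apply Rmult_le_reg_r with (t ^ k); [exact Hp|].
    replace (M * (rho ^ k / t ^ k) * t ^ k) with (M * rho ^ k) by (field; lra).
    assert (Cmod z ^ k <= rho ^ k) by (apply pow_incr; split; [apply Cmod_ge_0|exact Hz]).
    assert (0 <= Cmod z ^ k) by (apply pow_le, Cmod_ge_0).
    replace (Cmod (a k) * Cmod z ^ k * t ^ k) with ((Cmod (a k) * t ^ k) * Cmod z ^ k) by ring.
    apply Rmult_le_compat; auto. apply Rmult_le_pos; [apply Cmod_ge_0|lra].
Qed.

Lemma disc_sequence_taylor (a : nat -> C) : disc_sequence a -> exists f, is_taylor f a.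
Proof.
  intros H.
  exists (fun z => epsilon (inhabits (RtoC 0)) (clim (csum (fun k => a k * z ^ k)%C))).
  apply is_taylor_clim. intros z Hz. apply epsilon_spec.
  destruct (disc_sequence_geometric a (Cmod z) H) as [M [q [HM [Hq K]]]].
  { split; [apply Cmod_ge_0|exact Hz]. }
  apply clim_csum_exists with q M; [exact Hq|]. intros k. apply K. lra.
Qed.

Lemma is_taylor_bounded (f : C -> C) (a : nat -> C) (rho : R) : is_taylor f a -> 0 <= rho < 1 ->
  exists M, forall z, Cmod z <= rho -> Cmod (f z) <= M.
Proof.
  intros H Hrho.
  destruct (disc_sequence_geometric a rho (is_taylor_disc_sequence f a H) Hrho)
    as [M [q [HM [Hq K]]]].
  exists (M * / (1 - q)). intros z Hz.
  rewrite is_taylor_clim in H.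
  apply (clim_Cmod_le _ _ _ (H z ltac:(unfold inD; lra))).
  intros n. eapply Rle_trans; [apply Cmod_csum_le; intros k; apply K; exact Hz|].
  rewrite rsum_scal. apply Rmult_le_compat_l; [exact HM|]. now apply rsum_geometric.
Qed.

(** The witness is tau_j = sum_i a_(i+j) lambda^i, an infinite Horner scheme: division by z - lambda
    takes place on the coefficients. *)
Lemma tail_sums (f : C -> C) (a : nat -> C) (lambda : C) : is_taylor f a -> inD lambda ->
  exists tau : nat -> C, tau 0%nat = f lambda /\
    (forall j, tau j = a j + lambda * tau (S j))%C /\ disc_sequence tau.
Proof.
  intros H Hl. unfold inD in Hl. assert (Hl0 := Cmod_ge_0 lambda).
  assert (HD := is_taylor_disc_sequence f a H).
  assert (Hb : forall rho, Cmod lambda < rho < 1 -> exists M, 0 <= M /\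
     forall j i, Cmod (a (i + j)%nat * lambda ^ i) * rho ^ j <= M * (Cmod lambda / rho) ^ i).
  { intros rho Hrho. destruct (HD rho) as [M HM]; [lra|].
    assert (HM0 : 0 <= M) by (generalize (HM 0%nat) (Cmod_ge_0 (a 0%nat)); simpl; lra).
    exists M. split; [exact HM0|]. intros j i. specialize (HM (i + j)%nat).
    rewrite Cmod_mult, Cmod_pow.
    assert (E : (Cmod lambda / rho) ^ i = Cmod lambda ^ i / rho ^ i)
      by (unfold Rdiv; rewrite Rpow_mult_distr, pow_inv; reflexivity).
    assert (Hp : 0 < rho ^ i) by (apply pow_lt; lra).
    rewrite E. apply Rmult_le_reg_r with (rho ^ i); [exact Hp|].
    replace (M * (Cmod lambda ^ i / rho ^ i) * rho ^ i) with (M * Cmod lambda ^ i) by (field; lra).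
    rewrite pow_add in HM.
    replace (Cmod (a (i + j)%nat) * Cmod lambda ^ i * rho ^ j * rho ^ i)
      with ((Cmod (a (i + j)%nat) * (rho ^ i * rho ^ j)) * Cmod lambda ^ i) by ring.
    apply Rmult_le_compat_r; [apply pow_le, Hl0|exact HM]. }
  assert (Hq : forall rho, Cmod lambda < rho < 1 -> 0 <= Cmod lambda / rho < 1).
  { intros rho Hrho. split.
    - apply Rmult_le_pos; [lra|left; apply Rinv_0_lt_compat; lra].
    - apply Rmult_lt_reg_r with rho; [lra|]. unfold Rdiv. rewrite Rmult_assoc, Rinv_l; lra. }
  pose (tau := fun j => epsilon (inhabits (RtoC 0))
     (clim (csum (fun i => a (i + j)%nat * lambda ^ i)%C))).
  set (t := (1 + Cmod lambda) / 2). assert (Ht : Cmod lambda < t < 1) by (unfold t; lra).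
  assert (Htau : forall j, clim (csum (fun i => a (i + j)%nat * lambda ^ i)%C) (tau j)).
  { intros j. apply epsilon_spec. destruct (Hb t Ht) as [M [_ HM]].
    apply clim_csum_exists with (Cmod lambda / t) (M / t ^ j); [apply Hq, Ht|].
    intros i. specialize (HM j i). assert (Hp : 0 < t ^ j) by (apply pow_lt; lra).
    apply Rmult_le_reg_r with (t ^ j); [exact Hp|].
    eapply Rle_trans; [exact HM|]. right. field. lra. }
  exists tau. split; [|split].
  - eapply clim_unique; [apply Htau|]. rewrite is_taylor_clim in H.
    apply clim_ext with (csum (fun k => a k * lambda ^ k)%C); [|now apply H].
    intros n. apply csum_ext. intros k _. now rewrite Nat.add_0_r.
  - intros j. eapply clim_unique; [apply clim_succ, Htau|].
    apply clim_ext with (fun n => a j + lambda * csum (fun i => a (i + S j)%nat * lambda ^ i) n)%C.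
    + intros n. rewrite csum_split_first. rewrite <- csum_scal. simpl. f_equal; [ring|].
      apply csum_ext. intros k _. rewrite Nat.add_succ_r. simpl. ring.
    + apply clim_plus; [apply clim_const|apply clim_scal, Htau].
  (* The radius must exceed |lambda| for the tails to converge, and must be at least [rho] for the
     bound on [tau] to be of use there. *)
  - intros rho Hrho. set (t' := Rmax rho t).
    assert (Ht' : Cmod lambda < t' < 1).
    { unfold t'. split; [eapply Rlt_le_trans; [apply Ht|apply Rmax_r]|apply Rmax_lub_lt; lra]. }
    destruct (Hb t' Ht') as [M [HM0 HM]]. exists (M * / (1 - Cmod lambda / t')). intros j.
    assert (Hp : 0 < t' ^ j) by (apply pow_lt; lra).
    assert (B : Cmod (tau j) <= M / t' ^ j * / (1 - Cmod lambda / t')).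
    { apply (clim_Cmod_le _ _ _ (Htau j)). intros n.
      eapply Rle_trans; [apply Cmod_csum_le with (v := fun i => M / t' ^ j * (Cmod lambda / t') ^ i)|].
      - intros i. specialize (HM j i). apply Rmult_le_reg_r with (t' ^ j); [exact Hp|].
        eapply Rle_trans; [exact HM|]. right. field. lra.
      - rewrite rsum_scal. apply Rmult_le_compat_l; [|apply rsum_geometric, Hq, Ht'].
        apply Rmult_le_pos; [exact HM0|left; now apply Rinv_0_lt_compat]. }
    apply Rle_trans with (Cmod (tau j) * t' ^ j).
    + apply Rmult_le_compat_l; [apply Cmod_ge_0|]. apply pow_incr. split; [lra|apply Rmax_l].
    + apply Rmult_le_compat_r with (r := t' ^ j) in B; [|lra].
      eapply Rle_trans; [exact B|]. right.
      generalize (/ (1 - Cmod lambda / t')). intros x. field. lra.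
Qed.

(* [tau (S j)] are the Taylor coefficients of the difference quotient of [f] at [lambda]. *)
Lemma difference_quotient (f : C -> C) (a tau : nat -> C) (lambda : C) :
  is_taylor f a -> tau 0%nat = f lambda ->
  (forall j, tau j = a j + lambda * tau (S j))%C -> disc_sequence tau ->
  exists Q, is_taylor Q (fun j => tau (S j)) /\
    forall z, inD z -> (f z - f lambda = (z - lambda) * Q z)%C.
Proof.
  intros H H0 Hrec Htau.
  assert (Hq : disc_sequence (fun j => tau (S j))).
  { intros rho Hrho. set (t := (1 + rho) / 2). assert (Ht : rho < t < 1) by (unfold t; lra).
    destruct (Htau t) as [M HM]; [lra|]. exists (M / t). intros k.
    apply Rmult_le_reg_r with t; [lra|].
    replace (M / t * t) with M by (field; lra).
    eapply Rle_trans; [|apply (HM (S k))]. simpl.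
    rewrite Rmult_assoc. apply Rmult_le_compat_l; [apply Cmod_ge_0|].
    rewrite Rmult_comm. apply Rmult_le_compat_l; [lra|]. apply pow_incr. lra. }
  destruct (disc_sequence_taylor _ Hq) as [Q HQ]. exists Q. split; [exact HQ|].
  intros z Hz.
  (* Abel summation; the boundary term tau_n z^n tends to 0 because [tau] is a disc sequence. *)
  assert (E : forall n, csum (fun k => a k * z ^ k)%C n
    = (f lambda + (z - lambda) * csum (fun j => tau (S j) * z ^ j) n - tau n * z ^ n)%C).
  { intros n. induction n as [|n IH].
    - simpl. rewrite H0. ring.
    - simpl csum. rewrite IH, (Hrec n). simpl. ring. }
  assert (L : f z = (f lambda + (z - lambda) * Q z + RtoC (-1) * 0)%C).
  { rewrite is_taylor_clim in H, HQ.
    eapply clim_unique; [apply H, Hz|].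
    apply clim_ext with (fun n => f lambda + (z - lambda) * csum (fun j => tau (S j) * z ^ j) n
      + RtoC (-1) * (tau n * z ^ n))%C.
    - intros n. rewrite E. apply injective_projections; simpl; ring.
    - apply clim_plus; [apply clim_plus; [apply clim_const|apply clim_scal, HQ, Hz]|].
      apply clim_scal.
      destruct (disc_sequence_geometric tau (Cmod z) Htau) as [M [q [HM [Hq' K]]]].
      { split; [apply Cmod_ge_0|exact Hz]. }
      apply clim_geometric with q M; [exact Hq'|exact HM|]. intros n.
      replace (tau n * z ^ n - 0)%C with (tau n * z ^ n)%C by ring. apply K. lra. }
  rewrite L. ring.
Qed.

(** Dividing twice by w - z gives f(w) - f(z) - (w - z) Q(z) = (w - z)^2 Q'(w), where [Q'] is the
    difference quotient of [Q] and is bounded near z. The derivative is thus Q(z), without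
    differentiating the series term by term. *)
Lemma is_taylor_Hol (f : C -> C) (a : nat -> C) : is_taylor f a -> Hol f.
Proof.
  intros H. apply Hol_cdiff. intros z Hz.
  destruct (tail_sums f a z H Hz) as [tau [T0 [T1 T2]]].
  destruct (difference_quotient f a tau z H T0 T1 T2) as [Q [HQ EQ]].
  destruct (tail_sums Q _ z HQ Hz) as [tau' [T0' [T1' T2']]].
  destruct (difference_quotient Q _ tau' z HQ T0' T1' T2') as [Q' [HQ' EQ']].
  unfold inD in Hz. assert (Hz0 := Cmod_ge_0 z).
  destruct (is_taylor_bounded Q' _ ((1 + Cmod z) / 2) HQ') as [M HM]; [lra|].
  exists (Q z). apply cdiff_eps. intros e He.
  assert (HM0 : 0 <= M) by (eapply Rle_trans; [apply Cmod_ge_0|apply (HM 0%C)]; rewrite Cmod_0; lra).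
  exists (Rmin ((1 - Cmod z) / 2) (e / (M + 1))). split.
  { apply Rmin_glb_lt; [lra|]. apply Rdiv_lt_0_compat; lra. }
  intros w Hw.
  assert (W1 := Rlt_le_trans _ _ _ Hw (Rmin_l _ _)).
  assert (W2 := Rlt_le_trans _ _ _ Hw (Rmin_r _ _)).
  assert (Hwz : Cmod w <= (1 + Cmod z) / 2).
  { assert (T := Cmod_triangle z (w - z)). replace (z + (w - z))%C with w in T by ring. lra. }
  assert (Hw1 : inD w) by (unfold inD; lra).
  rewrite EQ by exact Hw1.
  replace ((w - z) * Q w - Q z * (w - z))%C with ((w - z) * (Q w - Q z))%C by ring.
  rewrite EQ', !Cmod_mult by exact Hw1. rewrite Rmult_comm.
  apply Rmult_le_compat_r; [apply Cmod_ge_0|].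
  apply Rmult_lt_compat_r with (r := M + 1) in W2; [|lra].
  unfold Rdiv in W2. rewrite Rmult_assoc, Rinv_l, Rmult_1_r in W2 by lra.
  assert (T := HM w Hwz). assert (T2w := Cmod_ge_0 (w - z)).
  assert (Cmod (w - z) * Cmod (Q' w) <= Cmod (w - z) * M) by (apply Rmult_le_compat_l; auto).
  nra.
Qed.

(** * The upper bound *)

Lemma Cmod_sqr (z : C) : Cmod z ^ 2 = fst z ^ 2 + snd z ^ 2.
Proof. exact (Cmod2_alt z). Qed.

(** Disposes of the boundary term of the telescoped identity in [schur_step], at some index beyond
    any given one. *)
Lemma disc_sequence_tail_small (tau : nat -> C) (rho c eps : R) (J : nat) :
  disc_sequence tau -> 0 <= rho < 1 -> 0 <= c -> 0 < eps ->
  exists n, (J <= n)%nat /\ c * (Cmod (tau n) * rho ^ n) ^ 2 < eps.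
Proof.
  intros H Hrho Hc He.
  destruct (disc_sequence_geometric tau rho H Hrho) as [M [q [HM [Hq K]]]].
  destruct (pow_small (q * q) (c * M ^ 2) eps) as [N HN].
  - nra.
  - apply Rmult_le_pos; [exact Hc|apply pow2_ge_0].
  - exact He.
  - exists (N + J)%nat. split; [lia|]. specialize (HN (N + J)%nat ltac:(lia)).
    assert (Hr : Cmod (RtoC rho) = rho) by (rewrite Cmod_R; apply Rabs_pos_eq; lra).
    specialize (K (RtoC rho) (N + J)%nat ltac:(lra)).
    rewrite Cmod_mult, Cmod_pow, Hr in K.
    eapply Rle_lt_trans; [|exact HN]. rewrite Rmult_assoc.
    apply Rmult_le_compat_l; [exact Hc|].
    rewrite (Rpow_mult_distr q q).
    replace (M ^ 2 * (q ^ (N + J) * q ^ (N + J))) with ((M * q ^ (N + J)) ^ 2) by ring.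
    apply pow_incr. split; [|exact K].
    apply Rmult_le_pos; [apply Cmod_ge_0|apply pow_le; lra].
Qed.

(** By Parseval, the terms of the squared L^2 mean of f on the circle of radius [R0]. *)
Definition dilated_term (R0 : R) (a : nat -> C) (j : nat) : R := (Cmod (a j) * R0 ^ j) ^ 2.

(* One step of the Schur algorithm in the Hardy space of the disc of radius [R0]:
   with [mu = lambda / R0] and [zeta = z / R0], write
   [f = f(lambda) (1 - |mu|^2) / (1 - conj mu * zeta) + b_mu(zeta) f1].
   If [tau] are the tail sums of [f] at [lambda], the scaled coefficients satisfy
   [A_j = T_j - mu T_(j+1)] and [A1_j = conj mu * T_j - T_(j+1)],
   so [|A_j|^2 - |A1_j|^2] telescopes. *)
Lemma schur_step (R0 : R) (f : C -> C) (a : nat -> C) (lambda : C) (S0 : R) :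
  0 < R0 < 1 -> Cmod lambda < R0 -> is_taylor f a ->
  (forall J, rsum (dilated_term R0 a) J <= S0) ->
  exists f1 a1, is_taylor f1 a1 /\
    (forall J, rsum (dilated_term R0 a1) J
       + (1 - (Cmod lambda / R0) ^ 2) * Cmod (f lambda) ^ 2 <= S0) /\
    forall z, inD z ->
      ((1 - Cconj lambda * z / R0 ^ 2) * f z
        = f lambda * (1 - (Cmod lambda / R0) ^ 2)%R + (lambda - z) / R0 * f1 z)%C.
Proof.
  intros HR Hl H HS.
  assert (HlD : inD lambda) by (unfold inD; lra).
  destruct (tail_sums f a lambda H HlD) as [tau [T0 [T1 T2]]].
  destruct (difference_quotient f a tau lambda H T0 T1 T2) as [Q [HQ EQ]].
  set (m2 := (Cmod lambda / R0) ^ 2).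
  assert (Hm2 : 0 <= m2 < 1).
  { unfold m2. assert (Hl0 := Cmod_ge_0 lambda).
    assert (0 <= Cmod lambda / R0 < 1); [|simpl; nra]. split.
    - apply Rmult_le_pos; [lra|left; apply Rinv_0_lt_compat; lra].
    - apply Rmult_lt_reg_r with R0; [lra|]. unfold Rdiv. rewrite Rmult_assoc, Rinv_l; lra. }
  assert (HR0 : RtoC R0 <> 0%C) by (intros E; apply RtoC_inj in E; lra).
  assert (Hm2C : RtoC (1 - m2) = (1 - lambda * Cconj lambda / (R0 * R0))%C).
  { rewrite <- Cmod2_conj, <- RtoC_mult, <- RtoC_div, <- RtoC_minus.
    - f_equal. unfold m2. field. lra.
    - nra. }
  (* Solving the decomposition for f1, with Q the difference quotient of f at lambda, gives f1 =
     conj(mu) f - (1 - |mu|^2) R0 Q, whose coefficients are read off at once. *)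
  pose (u := (Cconj lambda / R0)%C). pose (v := (- (RtoC (1 - m2) * R0))%C).
  exists (fun z => u * f z + v * Q z)%C, (fun j => u * a j + v * tau (S j))%C.
  split; [|split].
  - rewrite is_taylor_clim in H, HQ |- *. intros z Hz.
    apply clim_ext with (fun n => u * csum (fun k => a k * z ^ k) n
      + v * csum (fun k => tau (S k) * z ^ k) n)%C.
    + intros n. rewrite <- !csum_scal, <- csum_plus. apply csum_ext. intros k _. ring.
    + apply clim_plus; apply clim_scal; auto.
  - assert (E : forall J, rsum (dilated_term R0 (fun j => u * a j + v * tau (S j))%C) J
        + (1 - m2) * Cmod (f lambda) ^ 2
        = rsum (dilated_term R0 a) J + (1 - m2) * (Cmod (tau J) * R0 ^ J) ^ 2).
    { intros J. induction J as [|J IH].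
      - simpl rsum. rewrite T0. simpl. ring.
      - simpl rsum.
        enough (D : dilated_term R0 (fun j => u * a j + v * tau (S j))%C J
           + (1 - m2) * (Cmod (tau J) * R0 ^ J) ^ 2
           = dilated_term R0 a J + (1 - m2) * (Cmod (tau (S J)) * R0 ^ S J) ^ 2) by lra.
        unfold dilated_term.
        replace (u * a J + v * tau (S J))%C
          with (Cconj lambda / R0 * tau J - R0 * tau (S J))%C.
        2:{ unfold u, v. rewrite Hm2C, (T1 J). field. exact HR0. }
        replace (a J) with (tau J - lambda * tau (S J))%C by (rewrite (T1 J); ring).
        rewrite !Rpow_mult_distr, !Cmod_sqr. simpl pow.
        set (rJ := R0 ^ J).
        assert (Em : m2 = (fst lambda ^ 2 + snd lambda ^ 2) / (R0 * R0)).
        { unfold m2. rewrite <- Cmod_sqr. field. lra. }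
        rewrite Em. destruct (tau J) as [x y], (tau (S J)) as [x' y'], lambda as [p q].
        simpl. field. lra. }
    (* The boundary term in [E] has the wrong sign for a direct estimate at J. A violation at J
       persists at every later index, since partial sums increase, and is refuted where the boundary
       term is small. *)
    intros J. apply Rnot_lt_le. intros L.
    set (eps := rsum (dilated_term R0 (fun j => u * a j + v * tau (S j))%C) J
        + (1 - m2) * Cmod (f lambda) ^ 2 - S0).
    destruct (disc_sequence_tail_small tau R0 (1 - m2) eps J T2) as [n [Hn Hsmall]];
      [lra|lra|unfold eps; lra|].
    specialize (E n). specialize (HS n).
    assert (M := rsum_mono (dilated_term R0 (fun j => u * a j + v * tau (S j))%C) J n
      (fun k => pow2_ge_0 _) Hn).
    unfold eps in Hsmall. lra.
  - intros z Hz. specialize (EQ z Hz).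
    assert (Ef : (f z = f lambda + (z - lambda) * Q z)%C) by (rewrite <- EQ; ring).
    unfold u, v. rewrite Ef, Hm2C. field. exact HR0.
Qed.

(* [Y] bounds [(1 - |mu|^2) / |1 - conj mu * zeta|^2] and [q] bounds [|b_mu(zeta)|^2]. *)
Lemma bounded_interpolation (R0 Y q : R) (sigma : list C) :
  0 < R0 < 1 -> 0 <= Y -> 1 <= q ->
  (forall lambda, In lambda sigma -> Cmod lambda < R0 ^ 2 /\ forall z, inD z ->
     1 - (Cmod lambda / R0) ^ 2 <= Y * Cmod (1 - Cconj lambda * z / R0 ^ 2) ^ 2 /\
     Cmod ((lambda - z) / R0) ^ 2 <= q * Cmod (1 - Cconj lambda * z / R0 ^ 2) ^ 2) ->
  forall f a S0, is_taylor f a -> (forall J, rsum (dilated_term R0 a) J <= S0) ->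
  exists g, Hol g /\ agree_on sigma g f /\
    forall z, inD z -> Cmod (g z) ^ 2 <= Y * INR (length sigma) * q ^ length sigma * S0.
Proof.
  intros HR HY Hq. induction sigma as [|lambda sigma IH]; intros Hs f a S0 Hf HS.
  - exists (fun _ => RtoC 0). split; [apply Hol_const|]. split.
    + exists f. split; [now apply is_taylor_Hol with a|]. intros z _. unfold blaschke. simpl. ring.
    + intros z _. rewrite Cmod_0. simpl. lra.
  - destruct (Hs lambda (or_introl eq_refl)) as [Hl HlY].
    assert (HR2 : R0 ^ 2 < R0) by (simpl; nra).
    destruct (schur_step R0 f a lambda S0 HR ltac:(lra) Hf HS) as [f1 [a1 [Hf1 [HS1 E1]]]].
    set (m := 1 - (Cmod lambda / R0) ^ 2) in *.
    assert (Hl0 := Cmod_ge_0 lambda).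
    assert (Hm : 0 < m).
    { unfold m. assert (0 <= Cmod lambda / R0 < 1); [|simpl; nra]. split.
      - apply Rmult_le_pos; [lra|left; apply Rinv_0_lt_compat; lra].
      - apply Rmult_lt_reg_r with R0; [lra|]. unfold Rdiv. rewrite Rmult_assoc, Rinv_l; lra. }
    set (S1 := S0 - m * Cmod (f lambda) ^ 2).
    destruct (IH (fun l Hin => Hs l (or_intror Hin)) f1 a1 S1 Hf1) as [g1 [Hg1 [[h1 [Hh1 Eh1]] Bg1]]].
    { intros J. specialize (HS1 J). unfold S1. lra. }
    assert (HS1pos : 0 <= S1) by (specialize (HS1 0%nat); simpl rsum in HS1; unfold S1; lra).
    assert (HR0 : RtoC R0 <> 0%C) by (intros E; apply RtoC_inj in E; lra).
    set (den := fun z => (1 - Cconj lambda * z / R0 ^ 2)%C).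
    assert (Hden : forall z, inD z -> den z <> 0%C).
    { intros z Hz Ez. destruct (HlY z Hz) as [A _]. fold (den z) in A. rewrite Ez, Cmod_0 in A.
      rewrite pow_i in A by lia. fold m in A. lra. }
    assert (HolDen : Hol den).
    { apply Hol_minus; [apply Hol_const|]. apply Hol_mult; [|apply Hol_const].
      apply Hol_mult; [apply Hol_const|apply Hol_id]. }
    assert (Hden1 : forall z, inD z -> (1 - Cconj lambda * z <> 0)%C).
    { intros z Hz Ez. assert (Em : Cmod (Cconj lambda * z) = 1).
      { replace (Cconj lambda * z)%C with (RtoC 1) by (rewrite <- (Cplus_0_r (Cconj lambda * z)), <- Ez; ring).
        apply Cmod_1. }
      rewrite Cmod_mult, Cmod_conj in Em. unfold inD in Hz. generalize (Cmod_ge_0 z). nra. }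
    (* The Schur formula for f with f1 replaced by its own interpolant at the remaining nodes. *)
    exists (fun z => (f lambda * m + (lambda - z) / R0 * g1 z) / den z)%C. split; [|split].
    + apply Hol_div; [|exact HolDen|exact Hden].
      apply Hol_plus; [apply Hol_const|]. apply Hol_mult; [|exact Hg1].
      apply Hol_mult; [|apply Hol_const]. apply Hol_minus; [apply Hol_const|apply Hol_id].
    (* The dilated factor is the ordinary Blaschke factor times (1 - conj(lambda) z) / (R0 den),
       which is holomorphic, so divisibility by [blaschke] is preserved. *)
    + exists (fun z => (1 - Cconj lambda * z) / R0 / den z * h1 z)%C. split.
      * apply Hol_mult; [|exact Hh1]. apply Hol_div; [|exact HolDen|exact Hden].
        apply Hol_mult; [|apply Hol_const]. apply Hol_minus; [apply Hol_const|].
        apply Hol_mult; [apply Hol_const|apply Hol_id].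
      * intros z Hz. specialize (E1 z Hz). fold (den z) in E1. specialize (Eh1 z Hz).
        assert (Ef : (f z = (f lambda * m + (lambda - z) / R0 * f1 z) / den z)%C).
        { rewrite <- E1. field. now apply Hden. }
        assert (Ef1 : (f1 z = g1 z + blaschke sigma z * h1 z)%C) by (rewrite <- Eh1; ring).
        rewrite Ef, Ef1. change (blaschke (lambda :: sigma) z)
          with (blaschke_factor lambda z * blaschke sigma z)%C.
        unfold blaschke_factor. field. repeat split; auto.
    + intros z Hz. destruct (HlY z Hz) as [A1 A2]. fold (den z) in A1, A2. fold m in A1.
      specialize (Bg1 z Hz).
      assert (Hd : 0 < Cmod (den z)) by (apply Cmod_gt_0, Hden, Hz).
      set (k := length sigma) in *. simpl length.
      set (d := Cmod (den z)) in *.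
      set (x := Cmod (f lambda) * m). set (y := Cmod ((lambda - z) / R0) * Cmod (g1 z)).
      assert (B1 : Cmod ((f lambda * m + (lambda - z) / R0 * g1 z) / den z) <= (x + y) / d).
      { rewrite Cmod_div by (now apply Hden). fold d.
        apply Rmult_le_compat_r; [left; now apply Rinv_0_lt_compat|].
        eapply Rle_trans; [apply Cmod_triangle|]. rewrite !Cmod_mult, Cmod_R, Rabs_pos_eq by lra.
        apply Rle_refl. }
      set (K1 := Y * INR k * q ^ k) in *.
      set (P := m * Cmod (f lambda) ^ 2) in *.
      assert (HP : 0 <= P) by (apply Rmult_le_pos; [lra|apply pow2_ge_0]).
      assert (Hk : 0 <= INR k) by apply pos_INR.
      assert (Hqk : 1 <= q ^ k) by (now apply pow_R1_Rle).
      assert (HK1 : 0 <= K1) by (unfold K1; apply Rmult_le_pos; [apply Rmult_le_pos; lra|lra]).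
      assert (X2 : x ^ 2 <= (Y * d ^ 2) * P).
      { unfold x, P. replace ((Cmod (f lambda) * m) ^ 2) with (m * (m * Cmod (f lambda) ^ 2)) by ring.
        apply Rmult_le_compat_r; [exact HP|exact A1]. }
      assert (Y2 : y ^ 2 <= (q * d ^ 2 * K1) * S1).
      { unfold y. rewrite Rpow_mult_distr.
        replace (q * d ^ 2 * K1 * S1) with ((q * d ^ 2) * (K1 * S1)) by ring.
        apply Rmult_le_compat; auto using pow2_ge_0. }
      (* Cauchy-Schwarz, with the energy [S0] split into the part [P] spent at lambda and the part
         [S1] left for f1. Applied at each node, it makes the bound grow linearly in the number of
         nodes, up to powers of [q]. *)
      assert (CS : (x + y) ^ 2 <= (Y * d ^ 2 + q * d ^ 2 * K1) * (P + S1)).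
      { assert (0 <= Y * d ^ 2) by (apply Rmult_le_pos; [lra|apply pow2_ge_0]).
        assert (0 <= q * d ^ 2 * K1) by (apply Rmult_le_pos; [apply Rmult_le_pos; [lra|apply pow2_ge_0]|lra]).
        set (A := Y * d ^ 2) in *. set (B := q * d ^ 2 * K1) in *.
        assert (Hx : 0 <= x) by (apply Rmult_le_pos; [apply Cmod_ge_0|lra]).
        assert (Hy : 0 <= y) by (apply Rmult_le_pos; apply Cmod_ge_0).
        assert (XY : (x * y) ^ 2 <= (A * S1) * (B * P)).
        { replace ((A * S1) * (B * P)) with ((A * P) * (B * S1)) by ring.
          rewrite Rpow_mult_distr. apply Rmult_le_compat; auto using pow2_ge_0. }
        assert (AG : 2 * (x * y) <= A * S1 + B * P).
        { apply Rnot_lt_le. intros L.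
          assert (0 <= A * S1) by (apply Rmult_le_pos; lra).
          assert (0 <= B * P) by (apply Rmult_le_pos; lra).
          assert ((A * S1 + B * P) ^ 2 < (2 * (x * y)) ^ 2)
            by (simpl; rewrite !Rmult_1_r; apply Rmult_le_0_lt_compat; lra).
          assert (0 <= (A * S1 - B * P) ^ 2) by apply pow2_ge_0. nra. }
        nra. }
      assert (ES : P + S1 = S0) by (unfold S1; ring).
      rewrite ES in CS.
      assert (HS0 : 0 <= S0) by lra.
      apply Rle_trans with (((x + y) / d) ^ 2).
      { apply pow_incr. split; [apply Cmod_ge_0|exact B1]. }
      apply Rle_trans with ((Y + q * K1) * S0).
      { unfold Rdiv. rewrite Rpow_mult_distr, pow_inv.
        apply Rmult_le_reg_r with (d ^ 2); [now apply pow_lt|].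
        rewrite Rmult_assoc, Rinv_l, Rmult_1_r by (apply Rgt_not_eq; now apply pow_lt).
        eapply Rle_trans; [exact CS|]. right. ring. }
      apply Rmult_le_compat_r; [exact HS0|].
      unfold K1. rewrite S_INR. fold k. change (q ^ S k) with (q * q ^ k).
      assert (Hqq : 1 <= q * q ^ k) by nra.
      assert (HYq : Y * 1 <= Y * (q * q ^ k)) by (apply Rmult_le_compat_l; [exact HY|exact Hqq]).
      nra.
Qed.

Lemma floor_nat_spec (alpha : R) : 1 <= alpha ->
  (1 <= floor_nat alpha)%nat /\ INR (floor_nat alpha) <= alpha < INR (floor_nat alpha) + 1.
Proof.
  intros Ha. destruct (base_Int_part alpha) as [H1 H2]. unfold floor_nat.
  assert (Hz : (1 <= Int_part alpha)%Z).
  { assert (L : IZR 0 < IZR (Int_part alpha)) by (simpl; lra). apply lt_IZR in L. lia. }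
  rewrite INR_IZR_INZ, Z2Nat.id by lia. split; [lia|]. lra.
Qed.

(** Valid without restriction on the moduli: in the upper bound [zeta] may lie outside the unit
    disc, and the excess of |b_mu| over 1 is read off from the right-hand side. *)
Lemma blaschke_modulus_identity (mu zeta : C) :
  Cmod (1 - Cconj mu * zeta) ^ 2 - Cmod (mu - zeta) ^ 2
  = (1 - Cmod mu ^ 2) * (1 - Cmod zeta ^ 2).
Proof. rewrite !Cmod_sqr. destruct mu, zeta. simpl. ring. Qed.

(* The radius [R0 = exp (- delta)], [delta = (1 - r) / (4 n)], is so close to 1 that each
   factor [b_mu] is at most [1 + 8 / n] in square modulus on the larger disc. *)
Lemma dilated_blaschke_bounds (n : nat) (r delta R0 : R) (lambda : C) :
  (1 <= n)%nat -> 0 <= r < 1 -> delta = (1 - r) / (4 * INR n) -> R0 = exp (- delta) ->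
  Cmod lambda <= r ->
  Cmod lambda < R0 ^ 2 /\ forall z, inD z ->
     1 - (Cmod lambda / R0) ^ 2
       <= 8 / (1 - r) * Cmod (1 - Cconj lambda * z / R0 ^ 2) ^ 2 /\
     Cmod ((lambda - z) / R0) ^ 2
       <= (1 + 8 / INR n) * Cmod (1 - Cconj lambda * z / R0 ^ 2) ^ 2.
Proof.
  intros Hn Hr Hdelta HR Hl.
  assert (Hn1 : 1 <= INR n) by (apply (le_INR 1), Hn).
  assert (Hd : 0 < delta) by (rewrite Hdelta; apply Rdiv_lt_0_compat; lra).
  assert (Hd1 : 4 * delta <= 1 - r).
  { rewrite Hdelta. apply Rmult_le_reg_r with (INR n); [lra|].
    replace (4 * ((1 - r) / (4 * INR n)) * INR n) with (1 - r) by (field; lra). nra. }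
  assert (HR0 : 0 < R0) by (rewrite HR; apply exp_pos).
  assert (HR1 : R0 < 1) by (rewrite HR, <- exp_0; apply exp_increasing; lra).
  assert (HR2 : 1 - 2 * delta <= R0 ^ 2).
  { replace (R0 ^ 2) with (exp (- (2 * delta))).
    - generalize (exp_ineq1_le (- (2 * delta))). lra.
    - rewrite HR. simpl. rewrite Rmult_1_r, <- exp_plus. f_equal. ring. }
  assert (HR0C : RtoC R0 <> 0%C) by (intros E; apply RtoC_inj in E; lra).
  set (t := Cmod lambda) in *. assert (Ht : 0 <= t) by apply Cmod_ge_0.
  set (Q := R0 ^ 2) in *.
  assert (HQ : Q < 1) by (unfold Q; simpl; nra).
  (* Since 1 - R0^2 <= 2 delta <= (1 - r) / 2, the squared radius lies beyond the midpoint of t and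
     1. This yields |1 - conj(mu) zeta| >= (1 - t) / 2. *)
  assert (HQt : (1 + t) / 2 <= Q) by lra.
  split; [lra|]. intros z Hz. unfold inD in Hz. assert (Hz0 := Cmod_ge_0 z).
  set (mu := (lambda / R0)%C). set (zeta := (z / R0)%C).
  assert (Eden : (1 - Cconj lambda * z / R0 ^ 2 = 1 - Cconj mu * zeta)%C).
  { assert (Ec : Cconj mu = (Cconj lambda / R0)%C).
    { unfold mu, Cdiv. rewrite Cmult_conj. f_equal. rewrite <- RtoC_inv by lra.
      apply injective_projections; simpl; ring. }
    unfold zeta. rewrite Ec. field. exact HR0C. }
  assert (Enum : ((lambda - z) / R0 = mu - zeta)%C) by (unfold mu, zeta; field; exact HR0C).
  assert (Emu : Cmod mu = t / R0)
    by (unfold mu; rewrite Cmod_div, Cmod_R, Rabs_pos_eq by (auto; lra); reflexivity).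
  assert (Ezeta : Cmod zeta = Cmod z / R0)
    by (unfold zeta; rewrite Cmod_div, Cmod_R, Rabs_pos_eq by (auto; lra); reflexivity).
  rewrite Eden, Enum.
  set (den := Cmod (1 - Cconj mu * zeta)).
  assert (Em2 : (t / R0) ^ 2 = t ^ 2 / Q) by (unfold Q; field; lra).
  assert (HtQ : t / Q <= 2 * t / (1 + t)).
  { apply Rmult_le_reg_r with (Q * (1 + t)); [nra|].
    replace (t / Q * (Q * (1 + t))) with (t * (1 + t)) by (field; lra).
    replace (2 * t / (1 + t) * (Q * (1 + t))) with (t * (2 * Q)) by (field; lra).
    apply Rmult_le_compat_l; lra. }
  assert (Hden : (1 - t) / 2 <= den).
  { apply Rle_trans with (1 - t / Q).
    - apply Rle_trans with (1 - 2 * t / (1 + t)); [|lra].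
      apply Rmult_le_reg_r with (1 + t); [lra|].
      replace ((1 - 2 * t / (1 + t)) * (1 + t)) with (1 - t) by (field; lra). nra.
    - unfold den. assert (T := Cmod_triangle (1 - Cconj mu * zeta) (Cconj mu * zeta)).
      replace (1 - Cconj mu * zeta + Cconj mu * zeta)%C with (RtoC 1) in T by ring.
      rewrite Cmod_1, Cmod_mult, Cmod_conj, Emu, Ezeta in T.
      assert (t / R0 * (Cmod z / R0) <= t / Q); [|lra].
      replace (t / R0 * (Cmod z / R0)) with (t / Q * Cmod z) by (unfold Q; field; lra).
      assert (0 <= t / Q) by (apply Rmult_le_pos; [lra|left; apply Rinv_0_lt_compat; lra]).
      nra. }
  assert (HY : 1 - (t / R0) ^ 2 <= 8 / (1 - r) * den ^ 2).
  { rewrite Em2.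
    assert (t ^ 2 <= t ^ 2 / Q).
    { apply Rmult_le_reg_r with Q; [lra|]. unfold Rdiv. rewrite Rmult_assoc, Rinv_l by lra.
      assert (0 <= t ^ 2) by apply pow2_ge_0. nra. }
    apply Rle_trans with (2 * (1 - t)); [nra|].
    apply Rle_trans with (8 / (1 - r) * ((1 - t) / 2) ^ 2).
    - apply Rmult_le_reg_r with (1 - r); [lra|].
      replace (8 / (1 - r) * ((1 - t) / 2) ^ 2 * (1 - r)) with (2 * (1 - t) * (1 - t)) by (field; lra).
      apply Rmult_le_compat_l; lra.
    - apply Rmult_le_compat_l.
      + left. apply Rdiv_lt_0_compat; lra.
      + apply pow_incr. lra. }
  split; [exact HY|].
  (* The excess of |mu - zeta|^2 over den^2 is (1 - |mu|^2)(|zeta|^2 - 1). The second factor is at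
     most 4 delta and the first is bounded by [HY], which together give 8 / n times den^2. *)
  assert (Id := blaschke_modulus_identity mu zeta). fold den in Id.
  rewrite Emu, Ezeta in Id.
  assert (Ez2 : (Cmod z / R0) ^ 2 - 1 <= 4 * delta).
  { apply Rmult_le_reg_r with Q; [lra|].
    replace (((Cmod z / R0) ^ 2 - 1) * Q) with (Cmod z ^ 2 - Q) by (unfold Q; field; lra).
    assert (Cmod z ^ 2 <= 1) by (simpl; nra). nra. }
  assert (Hm : 0 <= 1 - (t / R0) ^ 2).
  { rewrite Em2. assert (t ^ 2 / Q <= 1); [|lra].
    apply Rmult_le_reg_r with Q; [lra|]. unfold Rdiv. rewrite Rmult_assoc, Rinv_l by lra. nra. }
  assert (E8 : 8 / INR n = 8 / (1 - r) * (4 * delta)).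
  { rewrite Hdelta. field. lra. }
  assert (P1 : (1 - (t / R0) ^ 2) * ((Cmod z / R0) ^ 2 - 1)
     <= 8 / (1 - r) * den ^ 2 * (4 * delta)).
  { apply Rle_trans with ((1 - (t / R0) ^ 2) * (4 * delta)).
    - apply Rmult_le_compat_l; [exact Hm|exact Ez2].
    - apply Rmult_le_compat_r; [lra|exact HY]. }
  rewrite E8. nra.
Qed.

Lemma Hinf_norm_le (g : C -> C) (M : R) :
  0 <= M -> (forall z, inD z -> Cmod (g z) <= M) -> fnorm Hinf g <= M.
Proof.
  intros HM H. simpl.
  destruct (Lub_Rbar_correct (fun x : R => exists z : C, inD z /\ x = Cmod (g z))) as [_ L].
  specialize (L (Finite M)).
  (* At infinite values [real] returns 0, and [0 <= M] settles these cases. *)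
  destruct (Lub_Rbar _) as [x| |]; simpl in *; try lra.
  - apply L. intros x' [z [Hz ->]]. now apply H.
Qed.

Lemma Rpower_pos (x y : R) : 0 < Rpower x y.
Proof. apply exp_pos. Qed.

(** The inequality y <= exp y at y = delta x / N, raised to the power s <= 2 N. It trades the growth
    of the weight for the decay of R0^(2k) and is the source of the powers of N in the constant. *)
Lemma weighted_exponential_bound (s N delta x : R) : 0 <= s <= 2 * N -> 0 < N -> 0 < delta -> 0 < x ->
  Rpower x s <= Rpower (N / delta) s * exp (2 * delta * x).
Proof.
  intros Hs HN Hd Hx.
  assert (Hy : x <= N / delta * exp (delta * x / N)).
  { apply Rmult_le_reg_r with (delta / N); [apply Rdiv_lt_0_compat; lra|].
    replace (N / delta * exp (delta * x / N) * (delta / N)) with (exp (delta * x / N)) by (field; lra).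
    replace (x * (delta / N)) with (delta * x / N) by (field; lra).
    generalize (exp_ineq1_le (delta * x / N)). lra. }
  apply Rle_trans with (Rpower (N / delta * exp (delta * x / N)) s).
  - apply Rle_Rpower_l; [lra|]. split; [exact Hx|exact Hy].
  - assert (0 < N / delta) by (apply Rdiv_lt_0_compat; lra).
    rewrite <- Rpower_mult_distr by (auto using exp_pos).
    apply Rmult_le_compat_l; [left; apply Rpower_pos|].
    unfold Rpower. rewrite ln_exp.
    assert (E : s * (delta * x / N) <= 2 * delta * x).
    { apply Rmult_le_reg_r with N; [exact HN|].
      replace (s * (delta * x / N) * N) with (s * (delta * x)) by (field; lra).
      assert (0 < delta * x) by (apply Rmult_lt_0_compat; lra). nra. }
    destruct E as [E|E]; [left; now apply exp_increasing|rewrite E; apply Rle_refl].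
Qed.

(** The factor 4 in [delta] contributes 4^N to the constant. It is absorbed into a second factor
    N^N, so that only an absolute constant multiplies N^(2N). *)
Lemma pow_4_le (N : nat) : (1 <= N)%nat -> 4 ^ N <= 4 * INR N ^ N.
Proof.
  intros H.
  destruct (Nat.eq_dec N 1) as [->|H1]; [simpl; lra|].
  destruct (Nat.eq_dec N 2) as [->|H2]; [simpl; lra|].
  destruct (Nat.eq_dec N 3) as [->|H3]; [simpl; lra|].
  assert (4 <= INR N) by (replace 4 with (INR 4) by (simpl; ring); apply le_INR; lia).
  assert (4 ^ N <= INR N ^ N) by (apply pow_incr; lra).
  assert (0 < 4 ^ N) by (apply pow_lt; lra). lra.
Qed.

Lemma rsum_le_Series (u : nat -> R) (n : nat) :
  (forall k, 0 <= u k) -> ex_series u -> rsum u n <= Series u.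
Proof.
  intros Hu Hex. assert (E : forall m, rsum u (S m) = sum_n u m).
  { intros m. induction m as [|m IH]; [rewrite sum_O; simpl; ring|].
    rewrite sum_Sn, <- IH. reflexivity. }
  apply Rle_trans with (rsum u (S n)); [apply rsum_mono; [exact Hu|lia]|].
  rewrite E. apply (is_lim_seq_incr_compare (sum_n u)).
  - exact (Series_correct u Hex).
  - intros m. rewrite sum_Sn. unfold plus; simpl. generalize (Hu (S m)). lra.
Qed.

(** Under the root: 8 from the kernel bound 8 / (1 - r), exp 8 from the n Blaschke factors, exp 1
    from the index shift in the weight, and 16 from [pow_4_le] squared. *)
Definition upper_constant : R := sqrt (128 * exp 9).

Lemma interpolant_bound (alpha : R) (n : nat) (r : R) (sigma : list C) (f : C -> C) :
  1 <= alpha -> (1 <= n)%nat -> 0 <= r < 1 -> (length sigma <= n)%nat ->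
  (forall lambda, In lambda sigma -> Cmod lambda <= r) ->
  mem (l2a alpha) f -> fnorm (l2a alpha) f <= 1 ->
  exists g, mem Hinf g /\ agree_on sigma g f /\
    fnorm Hinf g <= upper_constant * INR (floor_nat alpha) ^ (2 * floor_nat alpha)
      * Rpower (INR n / (1 - r)) ((2 * alpha - 1) / 2).
Proof.
  intros Ha Hn Hr Hlen Hs [Hex Hser] Hnorm. simpl in Hser, Hnorm.
  destruct (floor_nat_spec alpha Ha) as [HN1 HN]. set (N := floor_nat alpha) in *.
  assert (HNR : 1 <= INR N) by (apply (le_INR 1), HN1).
  assert (Hn1 : 1 <= INR n) by (apply (le_INR 1), Hn).
  set (s := 2 * (alpha - 1)).
  set (delta := (1 - r) / (4 * INR n)). set (R0 := exp (- delta)).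
  assert (Hd : 0 < delta) by (apply Rdiv_lt_0_compat; lra).
  assert (Hd1 : 4 * delta <= 1).
  { unfold delta. apply Rmult_le_reg_r with (INR n); [lra|].
    replace (4 * ((1 - r) / (4 * INR n)) * INR n) with (1 - r) by (field; lra). lra. }
  assert (HR0 : 0 < R0 < 1).
  { split; [apply exp_pos|]. unfold R0. rewrite <- exp_0. apply exp_increasing. lra. }
  set (X := INR n / (1 - r)).
  assert (HX : 0 < X) by (apply Rdiv_lt_0_compat; lra).
  assert (Htaylor : is_taylor f (coeffs f)) by exact (epsilon_spec _ (is_taylor f) Hex).
  assert (Hterm : forall k, 0 <= l2a_term alpha f k).
  { intros k. unfold l2a_term. apply Rmult_le_pos; [apply pow2_ge_0|].
    left. apply Rdiv_lt_0_compat; [lra|apply Rpower_pos]. }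
  assert (HSer1 : Series (l2a_term alpha f) <= 1).
  { assert (H0 := rsum_le_Series _ 0 Hterm Hser). simpl in H0.
    rewrite <- (sqrt_sqrt _ H0).
    assert (P := sqrt_pos (Series (l2a_term alpha f))). nra. }
  (* The weight involves k + 1 but the dilation R0^(2k) only k; the surplus exp (2 delta) is at most
     exp 1. *)
  set (S0 := Rpower (INR N / delta) s * exp 1).
  assert (HS : forall J, rsum (dilated_term R0 (coeffs f)) J <= S0).
  { intros J. apply Rle_trans with (rsum (fun k => S0 * l2a_term alpha f k) J).
    - apply rsum_le. intros k _. unfold dilated_term, l2a_term. rewrite Rpow_mult_distr.
      set (c2 := Cmod (coeffs f k) ^ 2). assert (Hc2 : 0 <= c2) by apply pow2_ge_0.
      assert (Hk : 0 < INR k + 1) by (generalize (pos_INR k); lra).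
      fold s. set (wt := Rpower (INR k + 1) s). assert (Hwt : 0 < wt) by apply Rpower_pos.
      replace (S0 * (c2 * (1 / wt))) with (c2 * (S0 / wt)) by (field; lra).
      apply Rmult_le_compat_l; [exact Hc2|].
      apply Rmult_le_reg_r with wt; [exact Hwt|].
      replace (S0 / wt * wt) with S0 by (field; lra).
      assert (W : wt <= Rpower (INR N / delta) s * exp (2 * delta * (INR k + 1))).
      { apply weighted_exponential_bound; try lra. unfold s; lra. }
      assert (ER : (R0 ^ k) ^ 2 = exp (- (2 * delta * INR k))).
      { unfold R0. rewrite <- pow_mult, <- Rpower_pow by apply exp_pos.
        unfold Rpower. rewrite ln_exp, mult_INR. f_equal. simpl. ring. }
      rewrite ER.
      apply Rle_trans with (exp (- (2 * delta * INR k))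
        * (Rpower (INR N / delta) s * exp (2 * delta * (INR k + 1)))).
      + apply Rmult_le_compat_l; [left; apply exp_pos|exact W].
      + unfold S0. replace (exp (- (2 * delta * INR k))
            * (Rpower (INR N / delta) s * exp (2 * delta * (INR k + 1))))
          with (Rpower (INR N / delta) s
            * (exp (- (2 * delta * INR k)) * exp (2 * delta * (INR k + 1)))) by ring.
        apply Rmult_le_compat_l; [left; apply Rpower_pos|].
        rewrite <- exp_plus. left. apply exp_increasing. lra.
    - rewrite rsum_scal. rewrite <- (Rmult_1_r S0) at 2.
      apply Rmult_le_compat_l.
      + apply Rmult_le_pos; left; [apply Rpower_pos|apply exp_pos].
      + exact (Rle_trans _ _ _ (rsum_le_Series _ J Hterm Hser) HSer1). }
  destruct (bounded_interpolation R0 (8 / (1 - r)) (1 + 8 / INR n) sigma HR0) with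
    (f := f) (a := coeffs f) (S0 := S0) as [g [Hg [Hagree Hbound]]].
  - left. apply Rdiv_lt_0_compat; lra.
  - assert (0 < 8 / INR n) by (apply Rdiv_lt_0_compat; lra). lra.
  - intros lambda Hin.
    apply (dilated_blaschke_bounds n r delta R0 lambda Hn Hr eq_refl eq_refl (Hs _ Hin)).
  - exact Htaylor.
  - exact HS.
  - set (M := upper_constant * INR N ^ (2 * N) * Rpower X ((2 * alpha - 1) / 2)).
    assert (HNN : 0 < INR N ^ (2 * N)) by (apply pow_lt; lra).
    assert (HM : 0 <= M).
    { unfold M. apply Rmult_le_pos; [apply Rmult_le_pos; [apply sqrt_pos|lra]|left; apply Rpower_pos]. }
    assert (HgM : forall z, inD z -> Cmod (g z) <= M).
    { intros z Hz. specialize (Hbound z Hz).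
      apply Rsqr_incr_0_var; [|exact HM]. rewrite !Rsqr_pow2.
      eapply Rle_trans; [exact Hbound|].
      assert (HqE : (1 + 8 / INR n) ^ length sigma <= exp 8).
      { assert (H8 : 0 < 8 / INR n) by (apply Rdiv_lt_0_compat; lra).
        apply Rle_trans with ((1 + 8 / INR n) ^ n); [apply Rle_pow; [lra|exact Hlen]|].
        apply Rle_trans with (exp (8 / INR n) ^ n).
        - apply pow_incr. split; [lra|apply exp_ineq1_le].
        - rewrite <- Rpower_pow by apply exp_pos. unfold Rpower. rewrite ln_exp.
          right. f_equal. field. lra. }
      assert (Hlen' : INR (length sigma) <= INR n) by (now apply le_INR).
      assert (HL0 := pos_INR (length sigma)).
      assert (HS0 : 0 < S0) by (apply Rmult_lt_0_compat; [apply Rpower_pos|apply exp_pos]).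
      apply Rle_trans with (8 * X * exp 8 * S0).
      { apply Rmult_le_compat_r; [lra|].
        apply Rmult_le_compat; [| |  |exact HqE].
        - apply Rmult_le_pos; [left; apply Rdiv_lt_0_compat; lra|exact HL0].
        - apply pow_le. assert (0 < 8 / INR n) by (apply Rdiv_lt_0_compat; lra). lra.
        - unfold X. replace (8 * (INR n / (1 - r))) with (8 / (1 - r) * INR n) by (field; lra).
          apply Rmult_le_compat_l; [left; apply Rdiv_lt_0_compat; lra|exact Hlen']. }
      assert (ES : S0 = Rpower (4 * INR N) s * Rpower X s * exp 1).
      { unfold S0. rewrite Rpower_mult_distr by lra. f_equal. f_equal.
        unfold delta, X. field. lra. }
      assert (EX : Rpower X ((2 * alpha - 1) / 2) ^ 2 = Rpower X s * X).
      { rewrite <- Rpower_pow by apply Rpower_pos. rewrite Rpower_mult.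
        rewrite <- (Rpower_1 X) at 3 by exact HX. rewrite <- Rpower_plus. f_equal.
        unfold s. simpl. field. }
      assert (H4 : Rpower (4 * INR N) s <= 16 * (INR N ^ (2 * N)) ^ 2).
      { apply Rle_trans with (Rpower (4 * INR N) (INR (2 * N))).
        - apply Rle_Rpower; [lra|]. rewrite mult_INR. simpl. unfold s. lra.
        - rewrite Rpower_pow by lra. rewrite Rpow_mult_distr.
          assert (P4 := pow_4_le N HN1).
          assert (HP4 : 0 < 4 ^ N) by (apply pow_lt; lra).
          replace (4 ^ (2 * N)) with ((4 ^ N) ^ 2) by (rewrite <- pow_mult; f_equal; lia).
          replace (INR N ^ (2 * N)) with ((INR N ^ N) ^ 2) by (rewrite <- pow_mult; f_equal; lia).
          replace (16 * ((INR N ^ N) ^ 2) ^ 2) with ((4 * INR N ^ N) ^ 2 * (INR N ^ N) ^ 2) by ring.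
          apply Rmult_le_compat_r; [apply pow2_ge_0|]. apply pow_incr. lra. }
      unfold M. rewrite !Rpow_mult_distr, EX, ES. unfold upper_constant.
      rewrite pow2_sqrt by (generalize (exp_pos 9); lra).
      replace (exp 9) with (exp 8 * exp 1) by (rewrite <- exp_plus; f_equal; ring).
      assert (HXs := Rpower_pos X s). assert (H8 := exp_pos 8). assert (H1 := exp_pos 1).
      apply Rle_trans with (8 * X * exp 8 * (16 * (INR N ^ (2 * N)) ^ 2 * Rpower X s * exp 1)).
      + apply Rmult_le_compat_l.
        { apply Rmult_le_pos; [apply Rmult_le_pos; lra|lra]. }
        apply Rmult_le_compat_r; [lra|]. apply Rmult_le_compat_r; [lra|exact H4].
      + right. ring. }
    exists g. split; [split; [exact Hg|exists M; exact HgM]|split; [exact Hagree|]].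
    apply Hinf_norm_le; [exact HM|exact HgM].
Qed.

Lemma Rbar_lub_least (E : Rbar -> Prop) (l : Rbar) :
  (forall x, E x -> Rbar_le x l) -> Rbar_le (Rbar_lub E) l.
Proof. intros H. apply (proj2_sig (Rbar_ex_lub E)). exact H. Qed.

Lemma Rbar_lub_ge (E : Rbar -> Prop) (x : Rbar) : E x -> Rbar_le x (Rbar_lub E).
Proof. intros H. now apply (proj2_sig (Rbar_ex_lub E)). Qed.

Lemma Rbar_glb_le (E : Rbar -> Prop) (x : Rbar) : E x -> Rbar_le (Rbar_glb E) x.
Proof. intros H. now apply (proj2_sig (Rbar_ex_glb E)). Qed.

Lemma Rbar_glb_greatest (E : Rbar -> Prop) (l : Rbar) :
  (forall x, E x -> Rbar_le l x) -> Rbar_le l (Rbar_glb E).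
Proof. intros H. apply (proj2_sig (Rbar_ex_glb E)). exact H. Qed.

Lemma C_interp_upper_bound (alpha : R) (n : nat) (r : R) :
  1 <= alpha -> (1 <= n)%nat -> 0 <= r < 1 ->
  Rbar_le (C_interp n r (l2a alpha) Hinf)
    (Finite (upper_constant * INR (floor_nat alpha) ^ (2 * floor_nat alpha)
      * Rpower (INR n / (1 - r)) ((2 * alpha - 1) / 2))).
Proof.
  intros Ha Hn Hr. apply Rbar_lub_least. intros c [sigma [Hlen [Hs ->]]].
  apply Rbar_lub_least. intros v [f [Hf [Hf1 ->]]].
  destruct (interpolant_bound alpha n r sigma f Ha Hn Hr Hlen Hs Hf Hf1) as [g [Hg [Hag Hb]]].
  eapply Rbar_le_trans; [apply Rbar_glb_le; exists g; eauto|]. exact Hb.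
Qed.

(** * The lower bound *)

(** The Taylor polynomial modulo z^n, stated through a holomorphic remainder so that it makes sense
    for a function given only as complex differentiable. *)
Definition jet (n : nat) (W : C -> C) (b : nat -> R) : Prop :=
  exists H, Hol H /\ forall z, inD z -> (W z = csum (fun k => b k * z ^ k) n + z ^ n * H z)%C.

Definition shift (b : nat -> R) (k : nat) : R := match k with O => 0 | S j => b j end.

(** Division by 1 - beta z, on coefficients. For [beta = 1] it yields the partial sums that enter
    the Fejer sum. *)
Fixpoint geometric_convolution (beta : R) (b : nat -> R) (k : nat) : R :=
  match k with O => b 0%nat | S j => b (S j) + beta * geometric_convolution beta b j end.

Lemma csum_shift (b : nat -> R) (z : C) (n : nat) :
  (csum (fun k => shift b k * z ^ k) n + shift b n * z ^ n
   = z * csum (fun k => b k * z ^ k) n)%C.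
Proof.
  induction n as [|n IH]; [simpl; ring|].
  simpl csum. rewrite IH. simpl. ring.
Qed.

Lemma jet_ext (n : nat) (W V : C -> C) (b c : nat -> R) :
  (forall z, inD z -> W z = V z) -> (forall k, (k < n)%nat -> b k = c k) ->
  jet n W b -> jet n V c.
Proof.
  intros HWV Hbc [H [HH E]]. exists H. split; [exact HH|]. intros z Hz.
  rewrite <- HWV by exact Hz. rewrite E by exact Hz. f_equal. apply csum_ext.
  intros k Hk. now rewrite Hbc.
Qed.

Lemma jet_scal (n : nat) (W : C -> C) (b : nat -> R) (c : R) :
  jet n W b -> jet n (fun z => c * W z)%C (fun k => c * b k).
Proof.
  intros [H [HH E]]. exists (fun z => c * H z)%C. split.
  - apply Hol_mult; [apply Hol_const|exact HH].
  - intros z Hz. rewrite E by exact Hz. rewrite Cmult_plus_distr_l, <- csum_scal.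
    f_equal; [apply csum_ext; intros k _; rewrite RtoC_mult; ring|ring].
Qed.

Lemma jet_plus_multiple (n : nat) (W K : C -> C) (b : nat -> R) :
  Hol K -> jet n W b -> jet n (fun z => W z + z ^ n * K z)%C b.
Proof.
  intros HK [H [HH E]]. exists (fun z => H z + K z)%C. split; [now apply Hol_plus|].
  intros z Hz. rewrite E by exact Hz. ring.
Qed.

Lemma jet_mult_linear (n : nat) (W : C -> C) (b : nat -> R) (r : R) :
  jet n W b -> jet n (fun z => (1 + r * z) * W z)%C (fun k => b k + r * shift b k).
Proof.
  intros [H [HH E]]. exists (fun z => r * shift b n + (1 + r * z) * H z)%C. split.
  - apply Hol_plus; [apply (Hol_const (r * shift b n)%C)|]. apply Hol_mult; [|exact HH].
    apply Hol_plus; [apply Hol_const|]. apply Hol_mult; [apply Hol_const|apply Hol_id].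
  - intros z Hz. rewrite E by exact Hz.
    replace (csum (fun k => (b k + r * shift b k)%R * z ^ k) n)%C
      with (csum (fun k => b k * z ^ k) n + r * csum (fun k => shift b k * z ^ k) n)%C.
    + assert (T := csum_shift b z n).
      replace (csum (fun k => shift b k * z ^ k) n)%C
        with (z * csum (fun k => b k * z ^ k) n - shift b n * z ^ n)%C by (rewrite <- T; ring).
      ring.
    + rewrite <- csum_scal, <- csum_plus. apply csum_ext. intros k _.
      rewrite RtoC_plus, RtoC_mult. ring.
Qed.

Lemma one_minus_neq_0 (beta : R) (z : C) : 0 <= beta <= 1 -> inD z -> (1 - beta * z <> 0)%C.
Proof.
  intros Hb Hz E. unfold inD in Hz.
  assert (Em : Cmod (beta * z) = 1).
  { replace (beta * z)%C with (RtoC 1) by (rewrite <- (Cplus_0_r (beta * z)), <- E; ring).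
    apply Cmod_1. }
  rewrite Cmod_mult, Cmod_R, Rabs_pos_eq in Em by lra. generalize (Cmod_ge_0 z). nra.
Qed.

Lemma one_plus_neq_0 (beta : R) (z : C) : 0 <= beta <= 1 -> inD z -> (1 + beta * z <> 0)%C.
Proof.
  intros Hb Hz. replace (1 + beta * z)%C with (1 - beta * - z)%C by ring.
  apply one_minus_neq_0; [exact Hb|]. unfold inD. now rewrite Cmod_opp.
Qed.

Lemma Hol_one_minus (beta : R) : Hol (fun z => 1 - beta * z)%C.
Proof.
  apply Hol_minus; [apply Hol_const|]. apply Hol_mult; [apply Hol_const|apply Hol_id].
Qed.

Lemma jet_div_linear (n : nat) (W : C -> C) (b : nat -> R) (beta : R) : 0 <= beta <= 1 ->
  jet n W b -> jet n (fun z => W z / (1 - beta * z))%C (geometric_convolution beta b).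
Proof.
  intros Hb [H [HH E]]. set (c := geometric_convolution beta b).
  exists (fun z => (H z + (beta * shift c n)%R) / (1 - beta * z))%C. split.
  - apply Hol_div; [|apply Hol_one_minus|intros z Hz; now apply one_minus_neq_0].
    apply Hol_plus; [exact HH|apply Hol_const].
  - intros z Hz. assert (Hne := one_minus_neq_0 beta z Hb Hz). rewrite E by exact Hz.
    replace (csum (fun k => b k * z ^ k) n)%C
      with (csum (fun k => c k * z ^ k) n + - beta * csum (fun k => shift c k * z ^ k) n)%C.
    + assert (T := csum_shift c z n).
      replace (csum (fun k => shift c k * z ^ k) n)%C
        with (z * csum (fun k => c k * z ^ k) n - shift c n * z ^ n)%C by (rewrite <- T; ring).
      rewrite RtoC_mult. field. exact Hne.
    + rewrite <- csum_scal, <- csum_plus. apply csum_ext. intros k _.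
      replace (b k) with (c k - beta * shift c k) by (destruct k; unfold c; simpl; ring).
      rewrite RtoC_minus, RtoC_mult. ring.
Qed.

(** The binomial coefficient C(p + k - 1, k), coefficient of z^k in (1 - z)^(-p). Each further
    division by 1 - z is one more partial summation. *)
Fixpoint multichoose (p : nat) : nat -> R :=
  match p with
  | O => fun k => match k with O => 1 | _ => 0 end
  | S q => fun k => rsum (multichoose q) (S k)
  end.

Lemma multichoose_nonneg (p k : nat) : 0 <= multichoose p k.
Proof.
  revert k. induction p as [|p IH]; intros k; [destruct k; simpl; lra|].
  exact (rsum_pos _ (S k) IH).
Qed.

Lemma multichoose_S_S (p k : nat) :
  multichoose (S p) (S k) = multichoose (S p) k + multichoose p (S k).
Proof. reflexivity. Qed.

Lemma multichoose_S_0 (p : nat) : multichoose p 0 = 1.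
Proof. induction p as [|p IH]; [reflexivity|]. simpl in *. rewrite IH. ring. Qed.

Lemma multichoose_1 (k : nat) : multichoose 1 k = 1.
Proof.
  induction k as [|k IH]; [apply multichoose_S_0|].
  rewrite multichoose_S_S, IH. simpl. ring.
Qed.

(** The closed ratio between consecutive orders. It gives both power bounds below by induction on p:
    the upper one serves the norm of the test function, the lower one its Fejer sum. *)
Lemma multichoose_absorption (p k : nat) :
  INR (S p) * multichoose (S (S p)) k = (INR k + INR (S p)) * multichoose (S p) k.
Proof.
  revert k. induction p as [|p IHp].
  - intros k. rewrite multichoose_1. change (INR 1) with 1. induction k as [|k IH].
    + rewrite multichoose_S_0. simpl. ring.
    + rewrite multichoose_S_S, multichoose_1, Rmult_plus_distr_l, IH, S_INR. ring.
  - assert (A : forall k, (INR k + 1) * multichoose (S (S p)) (S k)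
       = (INR k + INR (S (S p))) * multichoose (S (S p)) k).
    { intros k. assert (P0 : 0 < INR (S p)) by (apply lt_0_INR; lia).
      assert (E2 := IHp (S k)).
      rewrite (multichoose_S_S (S p) k) in E2 |- *.
      rewrite (S_INR (S p)). rewrite (S_INR k) in E2. set (P := INR (S p)) in *.
      set (x := multichoose (S (S p)) k) in *. set (y := multichoose (S p) (S k)) in *.
      nra. }
    intros k. induction k as [|k IH]; [rewrite !multichoose_S_0; simpl; ring|].
    rewrite multichoose_S_S, Rmult_plus_distr_l, IH, (S_INR k).
    specialize (A k). lra.
Qed.

Lemma multichoose_le (p k : nat) : multichoose (S p) k <= (INR k + 1) ^ p.
Proof.
  induction p as [|p IH]; [rewrite multichoose_1; simpl; lra|].
  assert (A := multichoose_absorption p k). rewrite S_INR in A.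
  assert (Hp := pos_INR p). assert (Hk := pos_INR k).
  assert (Hm := multichoose_nonneg (S p) k).
  apply Rle_trans with ((INR k + 1) * multichoose (S p) k).
  - apply Rmult_le_reg_l with (INR p + 1); [lra|]. rewrite A, <- Rmult_assoc.
    apply Rmult_le_compat_r; [exact Hm|]. nra.
  - change ((INR k + 1) ^ S p) with ((INR k + 1) * (INR k + 1) ^ p). apply Rmult_le_compat_l; [lra|exact IH].
Qed.

Lemma multichoose_ge (p k : nat) : (INR k + 1) ^ p / INR (fact p) <= multichoose (S p) k.
Proof.
  induction p as [|p IH]; [rewrite multichoose_1; simpl; lra|].
  assert (A := multichoose_absorption p k). rewrite S_INR in A.
  assert (Hp := pos_INR p). assert (Hk := pos_INR k).
  assert (Hf := INR_fact_lt_0 p).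
  change (fact (S p)) with (S p * fact p)%nat. rewrite mult_INR, S_INR.
  apply Rmult_le_reg_l with (INR p + 1); [lra|]. rewrite A.
  replace ((INR p + 1) * ((INR k + 1) ^ S p / ((INR p + 1) * INR (fact p))))
    with ((INR k + 1) * ((INR k + 1) ^ p / INR (fact p))) by (simpl; field; lra).
  apply Rmult_le_compat; [lra| |lra|exact IH].
  apply Rmult_le_pos; [apply pow_le; lra|left; now apply Rinv_0_lt_compat].
Qed.

Lemma jet_inverse_power (n p : nat) (beta : R) : 0 <= beta <= 1 ->
  jet n (fun z => / (1 - beta * z) ^ p)%C (fun k => beta ^ k * multichoose p k).
Proof.
  intros Hb. induction p as [|p IH].
  - destruct n as [|n].
    + exists (fun _ => RtoC 1). split; [apply Hol_const|]. intros z _. simpl. field.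
    + exists (fun _ => RtoC 0). split; [apply Hol_const|]. intros z _.
      rewrite csum_split_first.
      rewrite (csum_ext _ (fun k => 0 * 0)%C) by (intros k _; simpl; rewrite Rmult_0_r; ring).
      rewrite csum_scal. simpl. rewrite Rmult_1_l. field.
  - apply (jet_div_linear n _ _ beta Hb) in IH. revert IH. apply jet_ext.
    + intros z Hz. assert (Hne := one_minus_neq_0 beta z Hb Hz). simpl.
      field. split; [|exact Hne]. now apply Cpow_nz.
    + intros k _. induction k as [|k IHk]; [simpl; rewrite multichoose_S_0; ring|].
      rewrite multichoose_S_S. simpl geometric_convolution. rewrite IHk. simpl. ring.
Qed.

(** With r >= 0, each factor 1 + r z only adds nonnegative amounts to the coefficients, so those of
    the denominator alone bound them from below. *)
Lemma jet_quotient_lower (n p m : nat) (r beta : R) : 0 <= beta <= 1 -> 0 <= r ->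
  exists c, jet n (fun z => (1 + r * z) ^ m / (1 - beta * z) ^ p)%C c /\
    forall k, beta ^ k * multichoose p k <= c k.
Proof.
  intros Hb Hr. induction m as [|m [c [Hc Hle]]].
  - exists (fun k => beta ^ k * multichoose p k). split; [|intros; apply Rle_refl].
    generalize (jet_inverse_power n p beta Hb). apply jet_ext; [|reflexivity].
    intros z Hz. simpl. unfold Cdiv. ring.
  - exists (fun k => c k + r * shift c k). split.
    + generalize (jet_mult_linear n _ c r Hc). apply jet_ext; [|reflexivity].
      intros z Hz. simpl. unfold Cdiv. ring.
    + intros k. assert (0 <= shift c k).
      { destruct k as [|k]; [simpl; lra|]. simpl. eapply Rle_trans; [|apply Hle].
        apply Rmult_le_pos; [apply pow_le; lra|apply multichoose_nonneg]. }
      generalize (Hle k). nra.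
Qed.

Lemma jet_le (n m : nat) (W : C -> C) (b : nat -> R) : (m <= n)%nat -> jet n W b -> jet m W b.
Proof.
  induction 1 as [|n _ IH]; intros H; [exact H|]. apply IH.
  destruct H as [H [HH E]]. exists (fun z => b n + z * H z)%C. split.
  - apply Hol_plus; [apply Hol_const|]. apply Hol_mult; [apply Hol_id|exact HH].
  - intros z Hz. rewrite E by exact Hz. simpl. ring.
Qed.

(** * Coefficient averages over circles and the Fejer sum *)

Lemma Cconj_csum (u : nat -> C) (n : nat) : Cconj (csum u n) = csum (fun k => Cconj (u k)) n.
Proof.
  induction n as [|n IH]; simpl; [apply injective_projections; simpl; ring|].
  rewrite Cplus_conj, IH. reflexivity.
Qed.

Lemma Hol_csum (u : nat -> C -> C) (n : nat) :
  (forall k, (k < n)%nat -> Hol (u k)) -> Hol (fun z => csum (fun k => u k z) n).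
Proof.
  induction n as [|n IH]; intros H; simpl; [apply Hol_const|].
  apply Hol_plus; [apply IH; intros; apply H; lia|apply H; lia].
Qed.

Lemma Cpow_0_l (k : nat) : (0 < k)%nat -> (0 ^ k)%C = 0%C.
Proof. intros H. destruct k as [|k]; [lia|]. simpl. ring. Qed.

(* On the circle [|z| = rho], [conj z = rho^2 / z], so the low-order part of [W conj(z)^j]
   is the conjugate of a polynomial without constant term. *)
Lemma jet_coefficient (n j : nat) (W : C -> C) (b : nat -> R) (rho : R) :
  (j < n)%nat -> 0 < rho < 1 -> jet n W b ->
  exists T, Hol T /\ T 0%C = RtoC (b j * rho ^ (2 * j)) /\
    forall z, Cmod z = rho -> Re (W z * Cconj (z ^ j))%C = Re (T z).
Proof.
  intros Hj Hrho HW. apply (jet_le n (S j)) in HW; [|lia].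
  destruct HW as [H [HH E]].
  exists (fun z => csum (fun k => (b k * rho ^ (2 * k))%R * z ^ (j - k)) j
     + (rho ^ (2 * j))%R * (b j + z * H z))%C. split; [|split].
  - apply Hol_plus.
    + apply Hol_csum. intros k _. apply Hol_mult; [apply Hol_const|apply Hol_pow, Hol_id].
    + apply Hol_mult; [apply Hol_const|]. apply Hol_plus; [apply Hol_const|].
      apply Hol_mult; [apply Hol_id|exact HH].
  - rewrite (csum_ext _ (fun k => 0 * 0)%C), csum_scal.
    + rewrite RtoC_mult. ring.
    + intros k Hk. rewrite Cpow_0_l by lia. ring.
  - intros z Hz. assert (HzD : inD z) by (unfold inD; lra).
    assert (Hzz : forall k, (z ^ k * Cconj (z ^ k))%C = RtoC (rho ^ (2 * k))).
    { intros k. rewrite <- Cmod2_conj, Cmod_pow, Hz, <- pow_mult. do 2 f_equal. lia. }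
    rewrite E by exact HzD. cbn [csum].
    set (L := csum (fun k => (b k * rho ^ (2 * k))%R * z ^ (j - k))%C j).
    assert (EL : (csum (fun k => b k * z ^ k) j * Cconj (z ^ j))%C = Cconj L).
    { unfold L. rewrite Cconj_csum, Cmult_comm, <- csum_scal. apply csum_ext.
      intros k Hk. rewrite RtoC_mult, <- Hzz, !Cmult_conj, Cconj_conj.
      replace (z ^ j)%C with (z ^ k * z ^ (j - k))%C by (rewrite <- Cpow_add_r; f_equal; lia).
      rewrite Cmult_conj.
      replace (Cconj (RtoC (b k))) with (RtoC (b k)) by (apply injective_projections; simpl; ring).
      ring. }
    replace ((csum (fun k => b k * z ^ k) j + b j * z ^ j + z ^ S j * H z) * Cconj (z ^ j))%C
      with (csum (fun k => b k * z ^ k) j * Cconj (z ^ j)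
            + (z ^ j * Cconj (z ^ j)) * (b j + z * H z))%C by (simpl; ring).
    rewrite EL, Hzz. unfold Re. simpl. ring.
Qed.

(** The pairing of W with 1 + z + ... + z^(n-1) on a circle, encoded as the value at 0 of a
    holomorphic function with the same real part on that circle. This is the form that
    [Re_nonneg_center] can use. *)
Lemma jet_pairing (n : nat) (W : C -> C) (b : nat -> R) (rho : R) :
  0 < rho < 1 -> jet n W b ->
  exists T, Hol T /\ T 0%C = RtoC (rsum (fun j => b j * rho ^ (2 * j)) n) /\
    forall z, Cmod z = rho -> Re (W z * Cconj (csum (fun j => z ^ j) n))%C = Re (T z).
Proof.
  intros Hrho HW.
  assert (A : forall m, (m <= n)%nat ->
    exists T, Hol T /\ T 0%C = RtoC (rsum (fun j => b j * rho ^ (2 * j)) m) /\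
    forall z, Cmod z = rho -> Re (W z * Cconj (csum (fun j => z ^ j) m))%C = Re (T z)).
  { induction m as [|m IH]; intros Hm.
    - exists (fun _ => RtoC 0). split; [apply Hol_const|split; [reflexivity|]].
      intros z _. unfold Re. simpl. ring.
    - destruct IH as [T1 [H1 [E1 K1]]]; [lia|].
      destruct (jet_coefficient n m W b rho Hm Hrho HW) as [T2 [H2 [E2 K2]]].
      exists (fun z => T1 z + T2 z)%C. split; [now apply Hol_plus|split].
      + rewrite E1, E2, <- RtoC_plus. reflexivity.
      + intros z Hz. simpl csum. rewrite Cplus_conj, Cmult_plus_distr_l.
        unfold Re in *. simpl in *. rewrite <- K1, <- K2 by exact Hz. reflexivity. }
  apply A, le_n.
Qed.

(* Fejer: [G |E|^2] with [E = 1 + z + ... + z^(n-1)] is averaged over a circle. *)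
Lemma fejer_sum_le (n : nat) (G : C -> C) (c : nat -> R) (M : R) :
  Hol G -> (forall z, inD z -> Cmod (G z) <= M) -> jet n G c ->
  (forall k, (k < n)%nat -> 0 <= c k) ->
  rsum (fun k => rsum c (S k)) n <= M * INR n.
Proof.
  intros HG HM Hc Hpos.
  assert (HM0 : 0 <= M) by (eapply Rle_trans; [apply Cmod_ge_0|apply (HM 0%C)]; unfold inD; rewrite Cmod_0; lra).
  set (b := fun k => rsum c (S k)).
  set (E := fun z => csum (fun j => z ^ j)%C n).
  assert (HE : Hol E) by (apply Hol_csum; intros k _; apply Hol_pow, Hol_id).
  assert (Hone : forall z, inD z -> (1 - z <> 0)%C).
  { intros z Hz. replace (1 - z)%C with (1 - RtoC 1 * z)%C by ring.
    apply one_minus_neq_0; [lra|exact Hz]. }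
  (* Since E = (1 - z^n) / (1 - z), multiplying by E is, modulo z^n, dividing by 1 - z, which sums
     the coefficients. *)
  assert (HGE : jet n (fun z => G z * E z)%C b).
  { assert (J1 := jet_div_linear n G c 1 ltac:(lra) Hc).
    apply (jet_plus_multiple n _ (fun z => - (G z / (1 - RtoC 1 * z)))%C) in J1.
    - revert J1. apply jet_ext.
      + intros z Hz. assert (Hne := Hone z Hz).
        assert (Eg : (E z = (1 - z ^ n) / (1 - z))%C).
        { assert (S1 : ((1 - z) * E z = 1 - z ^ n)%C).
          { unfold E. clear. induction n as [|n IH]; [simpl; ring|].
            simpl csum. rewrite Cmult_plus_distr_l, IH. simpl. ring. }
          rewrite <- S1. field. exact Hne. }
        rewrite Eg, Cmult_1_l. field. exact Hne.
      + intros k _. induction k as [|k IHk]; [unfold b; simpl; ring|].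
        simpl geometric_convolution. rewrite IHk. unfold b. simpl. ring.
    - apply Hol_opp, Hol_div; [exact HG|apply Hol_one_minus|].
      intros z Hz. apply one_minus_neq_0; [lra|exact Hz]. }
  assert (HEE : jet n E (fun _ => 1)).
  { exists (fun _ => RtoC 0). split; [apply Hol_const|]. intros z _.
    unfold E. rewrite Cmult_0_r, Cplus_0_r. apply csum_ext. intros k _. ring. }
  assert (Hb : forall k, (k < n)%nat -> 0 <= b k).
  { intros k Hk. unfold b. simpl. generalize (Hpos k Hk). assert (0 <= rsum c k); [|lra].
    clear - Hpos Hk. induction k as [|k IH]; simpl; [lra|].
    generalize (IH ltac:(lia)) (Hpos k ltac:(lia)). lra. }
  (* On the circle M |E|^2 - Re (G |E|^2) >= 0. At the centre this compares the weighted sum of the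
     b_j with M times the sum of rho^(2j), which is at most M n. *)
  assert (Key : forall rho, 0 < rho < 1 -> rho ^ (2 * n) * rsum b n <= M * INR n).
  { intros rho Hrho.
    destruct (jet_pairing n _ b rho Hrho HGE) as [T [HT [T0 TE]]].
    destruct (jet_pairing n E _ rho Hrho HEE) as [T' [HT' [T0' TE']]].
    assert (P := Re_nonneg_center (fun z => M * T' z - T z)%C rho).
    assert (P0 : 0 <= Re (M * T' 0 - T 0)%C).
    { apply P; [|exact Hrho|].
      - apply Hol_minus; [|exact HT]. apply Hol_mult; [apply Hol_const|exact HT'].
      - intros z Hz. assert (HzD : inD z) by (unfold inD; lra).
        assert (R1 : Re (M * T' z - T z)%C = M * Re (T' z) - Re (T z)) by (unfold Re; simpl; ring).
        rewrite R1, <- TE, <- TE' by exact Hz. fold (E z).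
        replace (G z * E z * Cconj (E z))%C with (G z * (E z * Cconj (E z)))%C by ring.
        rewrite <- Cmod2_conj. set (e2 := Cmod (E z) ^ 2).
        assert (He2 : 0 <= e2) by apply pow2_ge_0.
        replace (Re (RtoC e2)) with e2 by reflexivity.
        replace (Re (G z * e2)%C) with (Re (G z) * e2) by (unfold Re; simpl; ring).
        assert (Rg : Re (G z) <= M).
        { eapply Rle_trans; [apply Rle_abs|]. eapply Rle_trans; [apply re_le_Cmod|]. now apply HM. }
        nra. }
    rewrite T0, T0' in P0.
    rewrite <- RtoC_mult, <- RtoC_minus in P0. unfold Re, RtoC in P0. cbn [fst] in P0.
    assert (B1 : rsum (fun j => 1 * rho ^ (2 * j)) n <= INR n).
    { apply Rle_trans with (rsum (fun _ => 1) n).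
      - apply rsum_le. intros k _. rewrite Rmult_1_l. rewrite <- (pow1 (2 * k)).
        apply pow_incr. lra.
      - clear. induction n as [|n IH]; [simpl; lra|]. rewrite S_INR. simpl. lra. }
    assert (B2 : rho ^ (2 * n) * rsum b n <= rsum (fun j => b j * rho ^ (2 * j)) n).
    { rewrite <- rsum_scal. apply rsum_le. intros k Hk. rewrite Rmult_comm.
      apply Rmult_le_compat_l; [now apply Hb|].
      replace (2 * n)%nat with (2 * k + (2 * n - 2 * k))%nat by lia. rewrite pow_add.
      assert (0 <= rho ^ (2 * k)) by (apply pow_le; lra).
      assert (rho ^ (2 * n - 2 * k) <= 1) by (rewrite <- (pow1 (2 * n - 2 * k)); apply pow_incr; lra).
      nra. }
    assert (M * rsum (fun j => 1 * rho ^ (2 * j)) n <= M * INR n) by (apply Rmult_le_compat_l; auto).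
    lra. }
  set (Sb := rsum b n) in *.
  destruct (Rle_lt_dec Sb (M * INR n)) as [L|L]; [exact L|exfalso].
  assert (HSb : 0 < Sb) by (generalize (Rmult_le_pos M (INR n) HM0 (pos_INR n)); lra).
  clearbody Sb.
  (* Passage to radius 1: by Bernoulli, rho = 1 - eta loses at most 2 n eta Sb, and this [eta] makes
     the loss less than half of the gap to be refuted. *)
  set (eta := Rmin (1 / 2) ((Sb - M * INR n) / (2 * (2 * INR n + 1) * Sb))).
  assert (Hn0 := pos_INR n).
  assert (Heta : 0 < eta).
  { apply Rmin_glb_lt; [lra|]. apply Rdiv_lt_0_compat; [lra|]. apply Rmult_lt_0_compat; lra. }
  assert (Heta1 : eta <= 1 / 2) by apply Rmin_l.
  assert (Heta2 : eta * (2 * (2 * INR n + 1) * Sb) <= Sb - M * INR n).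
  { assert (T := Rmin_r (1 / 2) ((Sb - M * INR n) / (2 * (2 * INR n + 1) * Sb))). fold eta in T.
    apply Rmult_le_compat_r with (r := 2 * (2 * INR n + 1) * Sb) in T.
    - eapply Rle_trans; [exact T|]. right. field. lra.
    - apply Rmult_le_pos; lra. }
  specialize (Key (1 - eta) ltac:(lra)).
  assert (Bern : 1 - 2 * INR n * eta <= (1 - eta) ^ (2 * n)).
  { assert (BB : forall m, 1 - INR m * eta <= (1 - eta) ^ m).
    { induction m as [|m IH]; [simpl; lra|]. rewrite S_INR. simpl pow.
      assert (0 <= INR m * eta * eta) by (repeat apply Rmult_le_pos; try lra; apply pos_INR).
      assert ((1 - eta) * (1 - INR m * eta) <= (1 - eta) * (1 - eta) ^ m)
        by (apply Rmult_le_compat_l; lra).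
      nra. }
    specialize (BB (2 * n)%nat). rewrite mult_INR in BB. simpl in BB. simpl. lra. }
  assert ((1 - 2 * INR n * eta) * Sb <= (1 - eta) ^ (2 * n) * Sb) by (apply Rmult_le_compat_r; lra).
  assert (0 < eta * Sb) by (apply Rmult_lt_0_compat; lra).
  assert (0 <= eta * Sb * INR n) by (apply Rmult_le_pos; lra).
  nra.
Qed.

(** * The test function and its norm *)

Lemma rsum_multichoose_succ (p n : nat) (x : R) :
  rsum (fun k => multichoose (S p) k * x ^ k) (S n)
  = rsum (fun k => multichoose p k * x ^ k) (S n)
    + x * rsum (fun k => multichoose (S p) k * x ^ k) n.
Proof.
  induction n as [|n IH].
  - cbn [rsum]. rewrite !multichoose_S_0. ring.
  - cbn [rsum] in *. rewrite multichoose_S_S. simpl pow. lra.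
Qed.

(** Multiplying a partial sum of order p + 1 by 1 - x gives at most the partial sum of order p,
    because the truncated terms are nonnegative. *)
Lemma rsum_multichoose_le (p n : nat) (x : R) : 0 <= x < 1 ->
  rsum (fun k => multichoose p k * x ^ k) n <= (/ (1 - x)) ^ p.
Proof.
  intros Hx. revert n. induction p as [|p IH]; intros n.
  - destruct n as [|n]; [simpl; lra|].
    assert (E : rsum (fun k => multichoose 0 k * x ^ k) (S n) = 1).
    { induction n as [|n IHn]; [simpl; ring|].
      change (rsum (fun k => multichoose 0 k * x ^ k) (S (S n)))
        with (rsum (fun k => multichoose 0 k * x ^ k) (S n) + 0 * x ^ S n).
      rewrite IHn. ring. }
    rewrite E. simpl. lra.
  - assert (Hpos : forall k, 0 <= multichoose (S p) k * x ^ k).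
    { intros k. apply Rmult_le_pos; [apply multichoose_nonneg|apply pow_le; lra]. }
    assert (A : (1 - x) * rsum (fun k => multichoose (S p) k * x ^ k) n <= (/ (1 - x)) ^ p).
    { destruct n as [|n].
      - cbn [rsum]. rewrite Rmult_0_r. apply pow_le. left. apply Rinv_0_lt_compat. lra.
      - apply Rle_trans with (2 := IH (S n)).
        assert (E := rsum_multichoose_succ p n x).
        assert (M := rsum_mono _ n (S n) Hpos ltac:(lia)). nra. }
    change ((/ (1 - x)) ^ S p) with (/ (1 - x) * (/ (1 - x)) ^ p).
    apply Rmult_le_reg_l with (1 - x); [lra|].
    rewrite <- Rmult_assoc, Rinv_r, Rmult_1_l by lra. exact A.
Qed.

Lemma rsum_term_le (u : nat -> R) (k : nat) : (forall j, 0 <= u j) -> u k <= rsum u (S k).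
Proof. intros H. simpl. generalize (rsum_pos u k H). lra. Qed.

Lemma is_taylor_inverse_power (rho : R) (p : nat) : 0 <= rho < 1 ->
  is_taylor (fun z => / (1 - rho * z) ^ p)%C (fun k => RtoC (rho ^ k * multichoose p k)).
Proof.
  intros Hrho.
  assert (HD : forall p, disc_sequence (fun k => RtoC (rho ^ k * multichoose p k))).
  { clear p. intros p t Ht. exists ((/ (1 - t)) ^ p). intros k.
    assert (Hm := multichoose_nonneg p k).
    assert (Hr : 0 <= rho ^ k <= 1).
    { split; [apply pow_le; lra|]. rewrite <- (pow1 k). apply pow_incr. lra. }
    assert (Ht0 : 0 <= t ^ k) by (apply pow_le; lra).
    rewrite Cmod_R, Rabs_pos_eq by (apply Rmult_le_pos; lra).
    apply Rle_trans with (multichoose p k * t ^ k).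
    - apply Rmult_le_compat_r; nra.
    - eapply Rle_trans; [|apply (rsum_multichoose_le p (S k) t Ht)].
      apply (rsum_term_le (fun k => multichoose p k * t ^ k)). intros j.
      apply Rmult_le_pos; [apply multichoose_nonneg|apply pow_le; lra]. }
  induction p as [|p IH].
  - apply is_taylor_clim. intros z Hz. apply clim_pred.
    apply clim_ext with (fun _ => RtoC 1).
    + intros n. rewrite csum_split_first.
      rewrite (csum_ext _ (fun k => 0 * 0)%C) by (intros k _; simpl; rewrite Rmult_0_r; ring).
      rewrite csum_scal. simpl. rewrite Rmult_1_l. ring.
    + simpl. replace (/ 1)%C with (RtoC 1) by field. apply clim_const.
  - destruct (disc_sequence_taylor _ (HD (S p))) as [g Hg].
    rewrite is_taylor_clim in IH, Hg |- *. intros z Hz. specialize (IH z Hz). specialize (Hg z Hz).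
    assert (Hne := one_minus_neq_0 rho z ltac:(lra) Hz).
    (* The sum g is identified by its functional equation (1 - rho z) g = (1 - rho z)^(-p), obtained
       by letting n grow in Pascal's rule for the partial sums. *)
    assert (E : g z = (/ (1 - rho * z) ^ p + rho * z * g z)%C).
    { eapply clim_unique; [apply clim_succ, Hg|].
      apply clim_ext with (fun n =>
        csum (fun k => (rho ^ k * multichoose p k)%R * z ^ k) (S n)
        + rho * z * csum (fun k => (rho ^ k * multichoose (S p) k)%R * z ^ k) n)%C.
      - intros n. induction n as [|n IHn].
        + cbn [csum]. rewrite !multichoose_S_0. ring.
        + cbn [csum] in *. rewrite multichoose_S_S.
          replace (RtoC (rho ^ S n * (multichoose (S p) n + multichoose p (S n))))
            with (RtoC (rho ^ S n * multichoose p (S n))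
                  + rho * RtoC (rho ^ n * multichoose (S p) n))%C
            by (apply injective_projections; simpl; ring).
          change (z ^ S n)%C with (z * z ^ n)%C.
          set (A := csum (fun k => (rho ^ k * multichoose (S p) k)%R * z ^ k)%C n) in *.
          set (B := csum (fun k => (rho ^ k * multichoose p k)%R * z ^ k)%C n) in *.
          set (x := RtoC (rho ^ n * multichoose (S p) n)) in *.
          set (y := RtoC (rho ^ S n * multichoose p (S n))) in *.
          rewrite <- IHn at 2. ring.
      - apply clim_plus; [apply clim_succ, IH|apply clim_scal, Hg]. }
    replace (/ (1 - rho * z) ^ S p)%C with (g z); [exact Hg|].
    assert (E2 : ((1 - rho * z) * g z = / (1 - rho * z) ^ p)%C).
    { replace ((1 - rho * z) * g z)%C with (g z - rho * z * g z)%C by ring.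
      rewrite E at 1. ring. }
    change ((1 - rho * z) ^ S p)%C with ((1 - rho * z) * (1 - rho * z) ^ p)%C.
    assert (Hp : ((1 - rho * z) ^ p <> 0)%C) by now apply Cpow_nz.
    replace (/ ((1 - rho * z) * (1 - rho * z) ^ p))%C
      with (/ (1 - rho * z) * / (1 - rho * z) ^ p)%C by (field; auto).
    rewrite <- E2. field. exact Hne.
Qed.

(** The difference quotient at 0 shifts the coefficients, which drives the induction. The two
    quotients agree off 0 by cancelling z, and at 0 by continuity. *)
Lemma is_taylor_unique (f g : C -> C) (a b : nat -> C) (k : nat) :
  is_taylor f a -> is_taylor g b -> (forall z, inD z -> f z = g z) -> a k = b k.
Proof.
  revert f g a b. induction k as [|k IH]; intros f g a b Hf Hg E;
    (assert (H0 : inD 0%C) by (unfold inD; rewrite Cmod_0; lra));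
    destruct (tail_sums f a 0 Hf H0) as [t [A0 [A1 A2]]];
    destruct (tail_sums g b 0 Hg H0) as [u [B0 [B1 B2]]].
  - replace (a 0%nat) with (t 0%nat) by (rewrite A1; ring).
    replace (b 0%nat) with (u 0%nat) by (rewrite B1; ring).
    rewrite A0, B0. now apply E.
  - destruct (difference_quotient f a t 0 Hf A0 A1 A2) as [P [HP EP]].
    destruct (difference_quotient g b u 0 Hg B0 B1 B2) as [Q [HQ EQ]].
    replace (a (S k)) with (t (S k)) by (rewrite A1; ring).
    replace (b (S k)) with (u (S k)) by (rewrite B1; ring).
    assert (Eoff : forall z, inD z -> z <> 0%C -> P z = Q z).
    { intros z Hz Hne. assert (T : (z * P z = z * Q z)%C).
      { specialize (EP z Hz). specialize (EQ z Hz). rewrite E, E in EP by assumption.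
        replace (z * P z)%C with ((z - 0) * P z)%C by ring. rewrite <- EP, EQ. ring. }
      replace (P z) with (/ z * (z * P z))%C by (field; exact Hne).
      rewrite T. field. exact Hne. }
    apply (IH P Q (fun j => t (S j)) (fun j => u (S j)) HP HQ). intros z Hz.
    destruct (Ceq_dec z 0%C) as [->|Hne]; [|now apply Eoff].
    assert (HD := Hol_minus P Q (is_taylor_Hol _ _ HP) (is_taylor_Hol _ _ HQ)).
    rewrite Hol_cdiff in HD. destruct (HD 0%C H0) as [l Hl].
    assert (Z : Cmod (P 0 - Q 0)%C = 0).
    { apply Rle_antisym; [|apply Cmod_ge_0]. apply Rnot_lt_le. intros L.
      destruct (cdiff_continuous _ _ _ (Cmod (P 0 - Q 0)%C / 2) Hl ltac:(lra)) as [del [Hdel K]].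
      set (x := Rmin (del / 2) (1 / 2)).
      assert (Hx : 0 < x) by (apply Rmin_glb_lt; lra).
      assert (Hx1 : x <= del / 2) by apply Rmin_l. assert (Hx2 : x <= 1 / 2) by apply Rmin_r.
      assert (Hxm : Cmod x = x) by (rewrite Cmod_R; apply Rabs_pos_eq; lra).
      specialize (K (RtoC x)). cbv beta in K. rewrite (Eoff (RtoC x)) in K.
      - replace (Q x - Q x - (P 0 - Q 0))%C with (- (P 0 - Q 0))%C in K by ring.
        rewrite Cmod_opp in K. replace (RtoC x - 0)%C with (RtoC x) in K by ring.
        rewrite Hxm in K. specialize (K ltac:(lra)). lra.
      - unfold inD. lra.
      - intros Ex. apply RtoC_inj in Ex. lra. }
    apply Cmod_eq_0 in Z. replace (P 0%C) with ((P 0 - Q 0) + Q 0)%C by ring. rewrite Z. ring.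
Qed.

(** As [coeffs] is a choice, the norm of a concrete function can be computed only through this
    uniqueness. *)
Lemma coeffs_eq (f : C -> C) (a : nat -> C) (k : nat) : is_taylor f a -> coeffs f k = a k.
Proof.
  intros H. apply (is_taylor_unique f f); [|exact H|reflexivity].
  exact (epsilon_spec _ (is_taylor f) (ex_intro _ a H)).
Qed.

Lemma nonneg_series_bounded (u : nat -> R) (M : R) :
  (forall k, 0 <= u k) -> (forall n, rsum u n <= M) -> ex_series u /\ Series u <= M.
Proof.
  intros Hu HM.
  assert (E : forall m, sum_n u m = rsum u (S m)).
  { intros m. induction m as [|m IH]; [rewrite sum_O; simpl; ring|].
    rewrite sum_Sn, IH. reflexivity. }
  assert (Hex : ex_series u).
  { destruct (ex_finite_lim_seq_incr (sum_n u) M) as [l Hl].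
    - intros m. rewrite sum_Sn. unfold plus; simpl. generalize (Hu (S m)). lra.
    - intros m. rewrite E. apply HM.
    - exists l. exact Hl. }
  split; [exact Hex|].
  assert (L : is_lim_seq (sum_n u) (Series u)) by exact (Series_correct u Hex).
  exact (is_lim_seq_le _ (fun _ => M) (Series u) M
    (fun m => eq_ind_r (fun x => x <= M) (HM (S m)) (E m)) L (is_lim_seq_const M)).
Qed.

Definition test_function (rho : R) (p : nat) (z : C) : C :=
  (RtoC (sqrt ((1 - rho ^ 2) ^ p)) * / (1 - rho * z) ^ p)%C.

(** For p + 1 = 2 alpha - 1 the weight is (k + 1)^p, which dominates [multichoose (S p) k]. One of
    the two factors in the squared coefficient cancels against it, and the binomial series in rho^2
    sums the other to the inverse of the normalising factor. *)
Lemma test_function_norm (alpha rho : R) (p : nat) :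
  0 <= rho < 1 -> 2 * alpha - 1 = INR (S p) ->
  mem (l2a alpha) (test_function rho (S p)) /\ fnorm (l2a alpha) (test_function rho (S p)) <= 1.
Proof.
  intros Hrho Hp. set (f := test_function rho (S p)).
  set (kap := sqrt ((1 - rho ^ 2) ^ S p)).
  assert (Hr2 : 0 <= rho ^ 2 < 1) by (simpl; nra).
  assert (Hk2 : kap ^ 2 = (1 - rho ^ 2) ^ S p) by (apply pow2_sqrt, pow_le; lra).
  assert (HT : is_taylor f (fun k => RtoC (kap * (rho ^ k * multichoose (S p) k)))).
  { assert (H := is_taylor_inverse_power rho (S p) Hrho).
    rewrite is_taylor_clim in H |- *. intros z Hz. specialize (H z Hz).
    apply (clim_scal (RtoC kap)) in H. revert H. apply clim_ext. intros n.
    rewrite <- csum_scal. apply csum_ext. intros k _. rewrite !RtoC_mult. ring. }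
  assert (Hterm : forall k, 0 <= l2a_term alpha f k).
  { intros k. unfold l2a_term. apply Rmult_le_pos; [apply pow2_ge_0|].
    left. apply Rdiv_lt_0_compat; [lra|apply Rpower_pos]. }
  assert (Hle : forall k, l2a_term alpha f k <= kap ^ 2 * (multichoose (S p) k * (rho ^ 2) ^ k)).
  { intros k. unfold l2a_term. rewrite (coeffs_eq f _ k HT), Cmod_R, pow2_abs.
    assert (Hk : 0 < INR k + 1) by (generalize (pos_INR k); lra).
    replace (2 * (alpha - 1)) with (INR p) by (rewrite S_INR in Hp; lra).
    rewrite Rpower_pow by exact Hk.
    assert (Hm := multichoose_nonneg (S p) k). assert (Hml := multichoose_le p k).
    set (m := multichoose (S p) k) in *. set (w := (INR k + 1) ^ p) in *.
    assert (Hw : 0 < w) by (apply pow_lt; lra).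
    rewrite !Rpow_mult_distr. rewrite <- (pow_mult rho k 2), <- (pow_mult rho 2 k), (Nat.mul_comm k 2).
    replace (kap ^ 2 * (rho ^ (2 * k) * m ^ 2) * (1 / w))
      with (kap ^ 2 * (rho ^ (2 * k) * m) * (m / w)) by (field; lra).
    replace (kap ^ 2 * (m * rho ^ (2 * k))) with (kap ^ 2 * (rho ^ (2 * k) * m) * 1) by ring.
    apply Rmult_le_compat_l.
    - apply Rmult_le_pos; [apply pow2_ge_0|]. apply Rmult_le_pos; [apply pow_le; lra|exact Hm].
    - apply Rmult_le_reg_r with w; [exact Hw|]. unfold Rdiv.
      rewrite Rmult_assoc, Rinv_l by lra. lra. }
  destruct (nonneg_series_bounded (l2a_term alpha f) 1 Hterm) as [Hex Hs].
  { intros n. eapply Rle_trans; [apply rsum_le; intros k _; apply Hle|].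
    rewrite rsum_scal, Hk2.
    apply Rle_trans with ((1 - rho ^ 2) ^ S p * (/ (1 - rho ^ 2)) ^ S p).
    - apply Rmult_le_compat_l; [apply pow_le; lra|]. now apply rsum_multichoose_le.
    - right. rewrite <- Rpow_mult_distr, Rinv_r by lra. apply pow1. }
  split.
  - split; [eexists; exact HT|exact Hex].
  - simpl. rewrite <- sqrt_1. now apply sqrt_le_1_alt.
Qed.

Lemma Hinf_norm_ge (g : C -> C) (z : C) : mem Hinf g -> inD z -> Cmod (g z) <= fnorm Hinf g.
Proof.
  intros [_ [M HM]] Hz. simpl.
  destruct (Lub_Rbar_correct (fun x : R => exists z : C, inD z /\ x = Cmod (g z))) as [L1 L2].
  specialize (L1 (Cmod (g z)) (ex_intro _ z (conj Hz eq_refl))).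
  specialize (L2 (Finite M)).
  destruct (Lub_Rbar _) as [x| |]; simpl in *.
  - exact L1.
  - exfalso. apply L2. intros y [w [Hw ->]]. now apply HM.
  - contradiction.
Qed.

Lemma blaschke_repeat (lambda z : C) (n : nat) :
  blaschke (repeat lambda n) z = (blaschke_factor lambda z ^ n)%C.
Proof.
  induction n as [|n IH]; [reflexivity|].
  change (blaschke (repeat lambda (S n)) z)
    with (blaschke_factor lambda z * blaschke (repeat lambda n) z)%C.
  now rewrite IH.
Qed.

Lemma disc_automorphism_inD (r : R) (z : C) : 0 <= r < 1 -> inD z ->
  inD ((r + z) / (1 + r * z))%C.
Proof.
  intros Hr Hz. assert (Hne := one_plus_neq_0 r z ltac:(lra) Hz).
  assert (Id := blaschke_modulus_identity r (- z)).
  replace (1 - Cconj r * - z)%C with (1 + r * z)%C in Id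
    by (apply injective_projections; simpl; ring).
  replace (r - - z)%C with (r + z)%C in Id by ring.
  rewrite Cmod_R, Rabs_pos_eq, Cmod_opp in Id by lra.
  unfold inD in *. rewrite Cmod_div by exact Hne.
  assert (Hd := proj1 (Cmod_gt_0 _) Hne).
  assert (Hz0 := Cmod_ge_0 z).
  apply Rmult_lt_reg_r with (Cmod (1 + r * z)); [exact Hd|].
  unfold Rdiv. rewrite Rmult_assoc, Rinv_l, Rmult_1_l, Rmult_1_r by lra.
  apply Rnot_le_lt. intros L.
  assert (Cmod (1 + r * z) ^ 2 <= Cmod (r + z) ^ 2) by (apply pow_incr; lra).
  assert (0 < (1 - r ^ 2) * (1 - Cmod z ^ 2)) by (apply Rmult_lt_0_compat; simpl; nra).
  lra.
Qed.

(* With [rho = (r + beta) / (1 + r beta)] the test function, transported by the automorphism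
   that moves the interpolation node to 0, has nonnegative Taylor coefficients. *)
Lemma test_function_transported (r beta rho : R) (p : nat) (z : C) :
  0 <= r < 1 -> 0 <= beta < 1 -> rho = (r + beta) / (1 + r * beta) -> inD z ->
  test_function rho p ((r + z) / (1 + r * z))%C
  = (RtoC (sqrt ((1 - rho ^ 2) ^ p) / (1 - rho * r) ^ p)
     * ((1 + r * z) ^ p / (1 - beta * z) ^ p))%C.
Proof.
  intros Hr Hb Hrho Hz.
  assert (H1 := one_plus_neq_0 r z ltac:(lra) Hz).
  assert (H2 := one_minus_neq_0 beta z ltac:(lra) Hz).
  assert (Hrb : 0 < 1 + r * beta) by nra.
  assert (H3 : 0 < 1 - rho * r).
  { rewrite Hrho. apply Rmult_lt_reg_r with (1 + r * beta); [exact Hrb|].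
    replace ((1 - (r + beta) / (1 + r * beta) * r) * (1 + r * beta)) with (1 - r * r) by (field; lra).
    nra. }
  assert (H3C : (1 - rho * r <> 0)%C).
  { rewrite <- RtoC_mult, <- RtoC_minus. intros E. apply RtoC_inj in E. lra. }
  (* The choice of [rho] solved for [beta], that is beta = (rho - r) / (1 - rho r): the pole 1 / rho
     moves to 1 / beta. *)
  assert (Eb : rho = r + beta * (1 - rho * r)) by (rewrite Hrho; field; lra).
  assert (EbC : RtoC rho = (r + beta * (1 - rho * r))%C).
  { rewrite Eb at 1. now rewrite RtoC_plus, RtoC_mult, RtoC_minus, RtoC_mult. }
  assert (E : (1 - rho * ((r + z) / (1 + r * z)) = (1 - rho * r) * (1 - beta * z) / (1 + r * z))%C).
  { replace (1 - rho * ((r + z) / (1 + r * z)))%C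
      with ((1 - rho * r + (r - rho) * z) / (1 + r * z))%C by (field; exact H1).
    f_equal. rewrite EbC at 2. ring. }
  unfold test_function. rewrite E, RtoC_div, RtoC_pow, RtoC_minus, RtoC_mult
    by (apply pow_nonzero; lra).
  set (s := RtoC (sqrt _)). clearbody s.
  set (u := (1 - rho * r)%C) in *. set (v := (1 - beta * z)%C) in *. set (w := (1 + r * z)%C) in *.
  clearbody u v w.
  assert (Hu : (u ^ p <> 0)%C) by now apply Cpow_nz.
  assert (Hv : (v ^ p <> 0)%C) by now apply Cpow_nz.
  assert (Hw : (w ^ p <> 0)%C) by now apply Cpow_nz.
  assert (Ep : ((u * v / w) ^ p = u ^ p * v ^ p / w ^ p)%C).
  { clear - H1. induction p as [|p IH]; [simpl; field|].
    assert (Hw : (w ^ p <> 0)%C) by now apply Cpow_nz.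
    change ((u * v / w) ^ S p)%C with (u * v / w * (u * v / w) ^ p)%C. rewrite IH.
    simpl. field. split; assumption. }
  rewrite Ep. field. repeat split; assumption.
Qed.

(** By conformal invariance (1 - rho^2) / (1 - rho r)^2 = (1 - beta^2) / (1 - r^2). Here 1 - beta^2
    >= 1 / (2n), so (2n)^2 lifts the quotient above n / (1 - r). The n^p is later supplied by the
    coefficients, while 2^p is paid in the constant. *)
Lemma kappa_lower (r beta rho X : R) (n p : nat) :
  0 <= r < 1 -> (1 <= n)%nat -> beta = INR n / (INR n + 1) ->
  rho = (r + beta) / (1 + r * beta) -> X = INR n / (1 - r) ->
  0 <= rho < 1 /\
  Rpower X (INR p / 2) <= sqrt ((1 - rho ^ 2) ^ p) / (1 - rho * r) ^ p * (2 * INR n) ^ p.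
Proof.
  intros Hr Hn Hbeta Hrho HX.
  assert (Hn1 : 1 <= INR n) by (apply (le_INR 1), Hn).
  assert (Hb : 0 <= beta < 1).
  { rewrite Hbeta. split; [left; apply Rdiv_lt_0_compat; lra|].
    apply Rmult_lt_reg_r with (INR n + 1); [lra|]. unfold Rdiv. rewrite Rmult_assoc, Rinv_l; lra. }
  assert (Hrb : 0 < 1 + r * beta) by nra.
  assert (H1mr : 1 - rho = (1 - r) * (1 - beta) / (1 + r * beta)) by (rewrite Hrho; field; lra).
  assert (Hrho01 : 0 <= rho < 1).
  { split.
    - rewrite Hrho. apply Rmult_le_pos; [lra|left; now apply Rinv_0_lt_compat].
    - assert (0 < 1 - rho); [|lra]. rewrite H1mr. apply Rdiv_lt_0_compat; [|exact Hrb].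
      apply Rmult_lt_0_compat; lra. }
  split; [exact Hrho01|].
  assert (HX0 : 0 < X) by (rewrite HX; apply Rdiv_lt_0_compat; lra).
  assert (Hd : 0 < 1 - rho * r) by nra.
  assert (Hr2 : 0 <= 1 - rho ^ 2) by (simpl; nra).
  assert (Hdp : 0 < (1 - rho * r) ^ p) by now apply pow_lt.
  assert (Hbase : X <= (1 - rho ^ 2) / (1 - rho * r) ^ 2 * (2 * INR n) ^ 2).
  { assert (E : (1 - rho ^ 2) / (1 - rho * r) ^ 2 = (1 - beta ^ 2) / (1 - r ^ 2)).
    { assert (E1 : 1 - rho * r = (1 - r ^ 2) / (1 + r * beta)) by (rewrite Hrho; field; lra).
      assert (E2 : 1 - rho ^ 2 = (1 - r ^ 2) * (1 - beta ^ 2) / (1 + r * beta) ^ 2)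
        by (rewrite Hrho; field; lra).
      assert (0 < 1 - r ^ 2) by (simpl; nra).
      rewrite E1, E2. field. lra. }
    rewrite E, HX.
    assert (B1 : 1 / (2 * INR n) <= 1 - beta ^ 2).
    { apply Rle_trans with (1 - beta); [|simpl; nra].
      replace (1 - beta) with (/ (INR n + 1)) by (rewrite Hbeta; field; lra).
      unfold Rdiv. rewrite Rmult_1_l. apply Rinv_le_contravar; lra. }
    assert (0 < 1 - r ^ 2) by (simpl; nra).
    apply Rmult_le_reg_r with ((1 - r) * (1 + r)); [nra|].
    replace (INR n / (1 - r) * ((1 - r) * (1 + r))) with (INR n * (1 + r)) by (field; lra).
    replace ((1 - beta ^ 2) / (1 - r ^ 2) * (2 * INR n) ^ 2 * ((1 - r) * (1 + r)))
      with ((1 - beta ^ 2) * (2 * INR n) ^ 2) by (field; lra).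
    apply Rle_trans with (1 / (2 * INR n) * (2 * INR n) ^ 2).
    - replace (1 / (2 * INR n) * (2 * INR n) ^ 2) with (INR n * 2) by (field; lra).
      apply Rmult_le_compat_l; lra.
    - apply Rmult_le_compat_r; [apply pow2_ge_0|exact B1]. }
  apply Rsqr_incr_0_var.
  - rewrite !Rsqr_pow2.
    replace (Rpower X (INR p / 2) ^ 2) with (X ^ p).
    2:{ rewrite <- (Rpower_pow 2) by apply Rpower_pos. rewrite Rpower_mult.
        rewrite <- Rpower_pow by exact HX0. f_equal. simpl. field. }
    replace ((sqrt ((1 - rho ^ 2) ^ p) / (1 - rho * r) ^ p * (2 * INR n) ^ p) ^ 2)
      with (((1 - rho ^ 2) / (1 - rho * r) ^ 2 * (2 * INR n) ^ 2) ^ p).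
    + apply pow_incr. split; [lra|exact Hbase].
    + unfold Rdiv. rewrite !Rpow_mult_distr, pow2_sqrt by now apply pow_le.
      rewrite !pow_inv, <- !pow_mult, !(Nat.mul_comm p 2). ring.
  - apply Rmult_le_pos; [|apply pow_le; lra].
    apply Rmult_le_pos; [apply sqrt_pos|left; now apply Rinv_0_lt_compat].
Qed.

Lemma interpolant_lower_bound (r : R) (n p : nat) :
  0 <= r < 1 -> (1 <= n)%nat ->
  exists rho, 0 <= rho < 1 /\
  forall g, mem Hinf g -> agree_on (repeat (RtoC r) n) g (test_function rho p) ->
    / (exp 1 * 2 ^ p * INR (fact (S p))) * Rpower (INR n / (1 - r)) (INR p / 2) <= fnorm Hinf g.
Proof.
  intros Hr Hn. set (X := INR n / (1 - r)). set (beta := INR n / (INR n + 1)).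
  set (rho := (r + beta) / (1 + r * beta)).
  assert (Hn1 : 1 <= INR n) by (apply (le_INR 1), Hn).
  assert (Hb : 0 <= beta < 1).
  { unfold beta. split; [left; apply Rdiv_lt_0_compat; lra|].
    apply Rmult_lt_reg_r with (INR n + 1); [lra|]. unfold Rdiv. rewrite Rmult_assoc, Rinv_l; lra. }
  destruct (kappa_lower r beta rho X n p Hr Hn eq_refl eq_refl eq_refl) as [Hrho Hkap].
  exists rho. split; [exact Hrho|]. intros g Hg [h [Hh Eh]].
  set (M := fnorm Hinf g).
  set (kap := sqrt ((1 - rho ^ 2) ^ p) / (1 - rho * r) ^ p) in *.
  assert (Hkap0 : 0 <= kap).
  { apply Rmult_le_pos; [apply sqrt_pos|left; apply Rinv_0_lt_compat, pow_lt; nra]. }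
  set (phi := fun z => ((r + z) / (1 + r * z))%C).
  assert (HphiD : forall z, inD z -> inD (phi z)) by (intros z Hz; now apply disc_automorphism_inD).
  assert (Hphi : Hol phi).
  { apply Hol_div.
    - apply Hol_plus; [apply Hol_const|apply Hol_id].
    - apply Hol_plus; [apply Hol_const|]. apply Hol_mult; [apply Hol_const|apply Hol_id].
    - intros z Hz. apply one_plus_neq_0; [lra|exact Hz]. }
  destruct (jet_quotient_lower n p p r beta ltac:(lra) ltac:(lra)) as [c [Hc Hcle]].
  (* Since b_r(phi(z)) = - z, agreement at the n-fold node r becomes agreement modulo z^n. *)
  assert (HG : jet n (fun z => g (phi z)) (fun k => kap * c k)).
  { apply (jet_scal n _ _ kap) in Hc.
    apply (jet_plus_multiple n _ (fun z => - ((- (1)) ^ n * h (phi z)))%C) in Hc.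
    - revert Hc. apply jet_ext; [|reflexivity]. intros z Hz.
      specialize (Eh (phi z) (HphiD z Hz)). rewrite blaschke_repeat in Eh.
      assert (H1 := one_plus_neq_0 r z ltac:(lra) Hz).
      assert (Hr2 : (1 - r * r <> 0)%C).
      { rewrite <- RtoC_mult, <- RtoC_minus. intros E. apply RtoC_inj in E. nra. }
      assert (Eb : blaschke_factor r (phi z) = ((- (1)) * z)%C).
      { unfold blaschke_factor, phi.
        replace (Cconj r) with (RtoC r) by (apply injective_projections; simpl; ring).
        field. split; [exact H1|].
        replace (1 + r * z - r * (r + z))%C with (1 - r * r)%C by ring. exact Hr2. }
      rewrite Eb, Cpow_mult_l in Eh.
      assert (Et := test_function_transported r beta rho p z Hr Hb eq_refl Hz).
      fold kap in Et. fold (phi z) in Et. rewrite Et in Eh.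
      replace (g (phi z)) with
        (kap * ((1 + r * z) ^ p / (1 - beta * z) ^ p)
         - (kap * ((1 + r * z) ^ p / (1 - beta * z) ^ p) - g (phi z)))%C by ring.
      rewrite Eh. ring.
    - apply Hol_opp, Hol_mult; [apply Hol_const|]. now apply Hol_comp. }
  assert (HGhol : Hol (fun z => g (phi z))) by (apply Hol_comp; [apply Hg|exact Hphi|exact HphiD]).
  assert (Hmc : forall k, 0 <= beta ^ k * multichoose p k).
  { intros k. apply Rmult_le_pos; [apply pow_le; lra|apply multichoose_nonneg]. }
  assert (F := fejer_sum_le n _ _ M HGhol (fun z Hz => Hinf_norm_ge g (phi z) Hg (HphiD z Hz)) HG
    (fun k _ => Rmult_le_pos _ _ Hkap0 (Rle_trans _ _ _ (Hmc k) (Hcle k)))).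
  (* Here 1 / beta = 1 + 1 / n, whose n-th power is at most e. *)
  assert (Hbn : forall k, (k < n)%nat -> / exp 1 <= beta ^ k).
  { intros k Hk. assert (E1 : (1 + / INR n) ^ k <= exp 1).
    { apply Rle_trans with ((1 + / INR n) ^ n).
      - apply Rle_pow; [|lia]. assert (0 < / INR n) by (apply Rinv_0_lt_compat; lra). lra.
      - apply Rle_trans with (exp (/ INR n) ^ n).
        + apply pow_incr. assert (0 < / INR n) by (apply Rinv_0_lt_compat; lra).
          split; [lra|apply exp_ineq1_le].
        + rewrite <- Rpower_pow by apply exp_pos. unfold Rpower. rewrite ln_exp.
          right. f_equal. field. lra. }
    replace (beta ^ k) with (/ (1 + / INR n) ^ k).
    - apply Rinv_le_contravar; [|exact E1]. apply pow_lt.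
      assert (0 < / INR n) by (apply Rinv_0_lt_compat; lra). lra.
    - rewrite <- pow_inv. f_equal. unfold beta. field. lra. }
  assert (He := exp_pos 1).
  assert (Hie : 0 < / exp 1) by now apply Rinv_0_lt_compat.
  assert (LB : kap * / exp 1 * multichoose (S (S p)) (n - 1) <= M * INR n).
  { eapply Rle_trans; [|exact F].
    (* The Fejer sum performs two more partial summations, raising the order from p to p + 2.
       Dividing by n later leaves n^p / (p + 1)!. *)
    assert (En : multichoose (S (S p)) (n - 1) = rsum (multichoose (S p)) n).
    { change (multichoose (S (S p)) (n - 1)) with (rsum (multichoose (S p)) (S (n - 1))).
      f_equal. lia. }
    rewrite En, <- rsum_scal. apply rsum_le. intros k Hk.
    change (multichoose (S p) k) with (rsum (multichoose p) (S k)).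
    rewrite <- rsum_scal. apply rsum_le. intros j Hj.
    rewrite Rmult_assoc. apply Rmult_le_compat_l; [exact Hkap0|].
    eapply Rle_trans; [|apply Hcle]. apply Rmult_le_compat_r; [apply multichoose_nonneg|].
    apply Hbn. lia. }
  assert (G := multichoose_ge (S p) (n - 1)).
  replace (INR (n - 1) + 1) with (INR n) in G by (rewrite minus_INR by exact Hn; simpl; ring).
  assert (Hf := INR_fact_lt_0 (S p)). set (Fc := INR (fact (S p))) in *.
  assert (Hnp : 0 < INR n ^ p) by (apply pow_lt; lra).
  assert (H2p : 0 < 2 ^ p) by (apply pow_lt; lra).
  assert (LB2 : kap * / exp 1 * (INR n ^ p / Fc) <= M).
  { apply Rmult_le_reg_r with (INR n); [lra|].
    eapply Rle_trans; [|exact LB].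
    replace (kap * / exp 1 * (INR n ^ p / Fc) * INR n)
      with (kap * / exp 1 * (INR n ^ S p / Fc)) by (simpl; field; lra).
    apply Rmult_le_compat_l; [apply Rmult_le_pos; lra|exact G]. }
  eapply Rle_trans; [|exact LB2].
  apply Rle_trans with (/ (exp 1 * 2 ^ p * Fc) * (kap * (2 * INR n) ^ p)).
  - apply Rmult_le_compat_l; [|exact Hkap].
    left. apply Rinv_0_lt_compat. repeat apply Rmult_lt_0_compat; lra.
  - right. rewrite Rpow_mult_distr. field. lra.
Qed.

Lemma C_interp_lower_bound (alpha r : R) (n p : nat) :
  2 * alpha - 1 = INR (S p) -> 0 <= r < 1 -> (1 <= n)%nat ->
  Rbar_le (Finite (/ (exp 1 * 2 ^ S p * INR (fact (S (S p))))
      * Rpower (INR n / (1 - r)) ((2 * alpha - 1) / 2)))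
    (C_interp n r (l2a alpha) Hinf).
Proof.
  intros Hp Hr Hn.
  destruct (interpolant_lower_bound r n (S p) Hr Hn) as [rho [Hrho H]].
  destruct (test_function_norm alpha rho p Hrho Hp) as [Hmem Hnorm].
  eapply Rbar_le_trans;
    [|apply Rbar_lub_ge; exists (repeat (RtoC r) n); split; [|split; [|reflexivity]]].
  - eapply Rbar_le_trans;
      [|apply Rbar_lub_ge; exists (test_function rho (S p)); split; [exact Hmem|split; [exact Hnorm|reflexivity]]].
    apply Rbar_glb_greatest. intros t [g [Hg [Hag ->]]]. rewrite Hp. exact (H g Hg Hag).
  - now rewrite repeat_length.
  - intros lambda Hin. apply repeat_spec in Hin. subst lambda.
    rewrite Cmod_R, Rabs_pos_eq; lra.
Qed.

(** * Comparison of the constants *)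

Lemma integer_index (alpha : R) : 1 <= alpha -> is_integer (2 * alpha - 1) ->
  exists p, 2 * alpha - 1 = INR (S p) /\ (S p <= 2 * floor_nat alpha)%nat.
Proof.
  intros Ha [m Hm]. destruct (floor_nat_spec alpha Ha) as [HN1 HN].
  assert (Hm1 : (1 <= m)%Z) by (apply le_IZR; rewrite <- Hm; lra).
  exists (Z.to_nat m - 1)%nat.
  assert (E : 2 * alpha - 1 = INR (S (Z.to_nat m - 1))).
  { replace (S (Z.to_nat m - 1)) with (Z.to_nat m) by lia.
    rewrite INR_IZR_INZ, Z2Nat.id by lia. exact Hm. }
  split; [exact E|].
  assert (L : INR (S (Z.to_nat m - 1)) < INR (S (2 * floor_nat alpha))).
  { rewrite <- E, (S_INR (2 * _)), mult_INR. simpl. lra. }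
  apply INR_lt in L. lia.
Qed.

(** The factorial of p + 1 can reach (2N + 1)!. The excess factor 2N + 1 is at most 3 times 2^N,
    which raises the power of 2 from 2N to 3N and leaves only the absolute constant 3. *)
Lemma lower_constant_le (p N : nat) : (p <= 2 * N)%nat ->
  / (3 * exp 1) * (1 / (2 ^ (3 * N) * INR (fact (2 * N))))
  <= / (exp 1 * 2 ^ p * INR (fact (S p))).
Proof.
  intros Hp. assert (He := exp_pos 1).
  assert (Hf1 := INR_fact_lt_0 (S p)). assert (Hf2 := INR_fact_lt_0 (2 * N)).
  assert (H2 : forall k, 0 < 2 ^ k) by (intros; apply pow_lt; lra).
  assert (A : 2 ^ p * INR (fact (S p)) <= 3 * (2 ^ (3 * N) * INR (fact (2 * N)))).
  { apply Rle_trans with (2 ^ (2 * N) * INR (fact (S (2 * N)))).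
    - apply Rmult_le_compat; [left; apply H2|lra| |].
      + apply Rle_pow; [lra|exact Hp].
      + apply le_INR, fact_le. lia.
    - change (fact (S (2 * N))) with (S (2 * N) * fact (2 * N))%nat.
      rewrite mult_INR, S_INR, (mult_INR 2 N).
      replace (3 * N)%nat with (2 * N + N)%nat by lia. rewrite pow_add.
      replace (2 ^ (2 * N) * ((INR 2 * INR N + 1) * INR (fact (2 * N))))
        with (2 ^ (2 * N) * INR (fact (2 * N)) * (INR 2 * INR N + 1)) by ring.
      replace (3 * (2 ^ (2 * N) * 2 ^ N * INR (fact (2 * N))))
        with (2 ^ (2 * N) * INR (fact (2 * N)) * (3 * 2 ^ N)) by ring.
      apply Rmult_le_compat_l.
      + apply Rmult_le_pos; [left; apply H2|lra].
      + assert (T : INR N + 1 <= 2 ^ N).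
        { clear. induction N as [|N IH]; [simpl; lra|]. rewrite S_INR. simpl pow.
          generalize (pos_INR N). lra. }
        simpl (INR 2). generalize (pos_INR N). lra. }
  assert (HB : 0 < 2 ^ (3 * N) * INR (fact (2 * N))) by (apply Rmult_lt_0_compat; [apply H2|exact Hf2]).
  assert (HA : 0 < 2 ^ p * INR (fact (S p))) by (apply Rmult_lt_0_compat; [apply H2|exact Hf1]).
  set (D := 2 ^ (3 * N) * INR (fact (2 * N))) in *. clearbody D.
  replace (/ (3 * exp 1) * (1 / D)) with (/ (exp 1 * (3 * D))) by (field; lra).
  rewrite Rmult_assoc. apply Rinv_le_contravar.
  - apply Rmult_lt_0_compat; assumption.
  - apply Rmult_le_compat_l; lra.
Qed.

Theorem mainTheorem2 :
  exists a A : R -> R,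
    asymp_on (fun alpha => 1 <= alpha /\ is_integer (2 * alpha - 1)) a
      (fun alpha => 1 / (2 ^ (3 * floor_nat alpha) * INR (fact (2 * floor_nat alpha)))) /\
    asymp_on (fun alpha => 1 <= alpha) A
      (fun alpha => INR (floor_nat alpha) ^ (2 * floor_nat alpha)) /\
    (forall alpha : R, 1 <= alpha -> is_integer (2 * alpha - 1) ->
      0 < a alpha /\
      forall (n : nat) (r : R), (1 <= n)%nat -> 0 <= r < 1 ->
        Rbar_le (Finite (a alpha * Rpower (INR n / (1 - r)) ((2 * alpha - 1) / 2)))
                (C_interp n r (l2a alpha) Hinf)) /\
    (forall alpha : R, 1 <= alpha ->
      0 < A alpha /\
      forall (n : nat) (r : R), (1 <= n)%nat -> 0 <= r < 1 ->
        Rbar_le (C_interp n r (l2a alpha) Hinf)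
                (Finite (A alpha * Rpower (INR n / (1 - r)) ((2 * alpha - 1) / 2)))).
Proof.
  assert (Hlow : 0 < / (3 * exp 1)) by (apply Rinv_0_lt_compat; generalize (exp_pos 1); lra).
  assert (Hup : 0 < upper_constant) by (apply sqrt_lt_R0; generalize (exp_pos 9); lra).
  exists (fun alpha => / (3 * exp 1)
    * (1 / (2 ^ (3 * floor_nat alpha) * INR (fact (2 * floor_nat alpha))))).
  exists (fun alpha => upper_constant * INR (floor_nat alpha) ^ (2 * floor_nat alpha)).
  split; [|split; [|split]].
  - exists (/ (3 * exp 1)), (/ (3 * exp 1)). repeat split; try assumption; apply Rle_refl.
  - exists upper_constant, upper_constant. repeat split; try assumption; apply Rle_refl.
  - intros alpha Ha Hint. destruct (integer_index alpha Ha Hint) as [p [Hp HpN]]. split.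
    + apply Rmult_lt_0_compat; [exact Hlow|]. apply Rdiv_lt_0_compat; [lra|].
      apply Rmult_lt_0_compat; [apply pow_lt; lra|apply INR_fact_lt_0].
    + intros n r Hn Hr. eapply Rbar_le_trans; [|exact (C_interp_lower_bound alpha r n p Hp Hr Hn)].
      apply Rmult_le_compat_r; [left; apply Rpower_pos|]. now apply lower_constant_le.
  - intros alpha Ha. split.
    + apply Rmult_lt_0_compat; [exact Hup|]. apply pow_lt.
      apply lt_0_INR. destruct (floor_nat_spec alpha Ha). lia.
    + intros n r Hn Hr. now apply C_interp_upper_bound.
Qed.
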